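(* Let $n,m,p$ be positive integers with $p\le m\le n-p$. Let $\mathbf{G}\in\mathbb{C}^{n\times p}$ be a deterministic matrix of full column rank $p$ whose columns are $\mathbf{g}_i=\partial\mathbf{x}(\boldsymbol{\theta})/\partial\theta_i$, let $\sigma^2>0$, and let $\mathbf{\Phi}\in\mathbb{C}^{m\times n}$ be a random matrix having a density with respect to Lebesgue measure on $\mathbb{C}^{m\times n}$ of the form $g(\mathbf{\Phi}\mathbf{\Phi}^H)$ for some function $g$. Let $\mathbf{J}=\frac{1}{\sigma^2}\mathbf{G}^H\mathbf{G}$ and $\hat{\mathbf{J}}=\frac{1}{\sigma^2}\mathbf{G}^H\mathbf{P}_{\mathbf{\Phi}^H}\mathbf{G}$, where $\mathbf{P}_{\mathbf{\Phi}^H}=\mathbf{\Phi}^H(\mathbf{\Phi}\mathbf{\Phi}^H)^{-1}\mathbf{\Phi}$. Then for every $i\in\{1,\dots,p\}$ the ratio $$\frac{(\hat{\mathbf{J}}^{-1})_{ii}}{(\mathbf{J}^{-1})_{ii}}$$ of the Cram\'er-Rao bound for $\theta_i$ after compression to the Cram\'er-Rao bound for $\theta_i$ before compression is distributed as the inverse (reciprocal) of a univariate Type I beta random variable $B^I(m-p+1,n-m)$.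
   Context: Model: $\mathbf{y}\in\mathbb{C}^n$ is a proper complex normal vector distributed as $\mathcal{CN}(\mathbf{x}(\boldsymbol{\theta}),\sigma^2\mathbf{I}_n)$ with mean parameterized by $\boldsymbol{\theta}\in\mathbb{R}^p$; its Fisher information matrix is $\mathbf{J}$, and $(\mathbf{J}^{-1})_{ii}$ is the Cram\'er-Rao bound for estimating $\theta_i$ from $\mathbf{y}$. The compressed data $\mathbf{\Phi}\mathbf{y}\sim\mathcal{CN}(\mathbf{\Phi}\mathbf{x}(\boldsymbol{\theta}),\sigma^2\mathbf{\Phi}\mathbf{\Phi}^H)$ has (for given $\mathbf{\Phi}$) Fisher information matrix $\hat{\mathbf{J}}$, and $(\hat{\mathbf{J}}^{-1})_{ii}$ is the Cram\'er-Rao bound for $\theta_i$ after compression. The superscript $H$ is conjugate transpose. $B^I(a,b)$ is the Type I beta distribution on $(0,1)$ with density $\frac{\Gamma(a+b)}{\Gamma(a)\Gamma(b)}x^{a-1}(1-x)^{b-1}$. *)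

(* Defs.v *)
From HB Require Import structures.
From mathcomp Require Import all_boot all_order all_algebra.
From mathcomp Require Import all_classical all_reals all_analysis.
From mathcomp Require Import complex.

Set Implicit Arguments.
Unset Strict Implicit.
Unset Printing Implicit Defensive.

Import Order.TTheory GRing.Theory Num.Theory.
Import numFieldNormedType.Exports.

Local Open Scope classical_set_scope.
Local Open Scope ring_scope.
Local Open Scope complex_scope.
Local Open Scope sesquilinear_scope.

HB.instance Definition _ (R : realType) := isPointed.Build R[i] 0.

Section complex_measurable.
Context (R : realType).

(* The sigma-algebra making [Re] and [Im] measurable, i.e. that of R^2. *)
Definition complex_measurable : set (set R[i]) :=
  g_sigma_preimageU (@complex.Re R) (@complex.Im R).

Let complex_measurable0 : complex_measurable set0.
Proof. exact: sigma_algebra0. Qed.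

Let complex_measurableC A :
  complex_measurable A -> complex_measurable (~` A).
Proof. exact: sigma_algebraC. Qed.

Let complex_measurable_bigcup (F : (set R[i])^nat) :
  (forall i, complex_measurable (F i)) -> complex_measurable (\bigcup_i F i).
Proof. exact: sigma_algebra_bigcup. Qed.

HB.instance Definition _ := @isMeasurable.Build
  (sigma_display complex_measurable) R[i] complex_measurable
  complex_measurable0 complex_measurableC complex_measurable_bigcup.

End complex_measurable.

Definition mx_display : measure_display -> measure_display.
Proof. exact. Qed.

Section mx_measurable.
Context d (T : measurableType d) (m n : nat).

Definition mx_measurable : set (set 'M[T]_(m, n)) :=
  <<s \bigcup_(ij in [set: 'I_m * 'I_n])
      preimage_set_system [set: 'M[T]_(m, n)]
        (fun A : 'M[T]_(m, n) => A ij.1 ij.2) measurable >>.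

Let mx_measurable0 : mx_measurable set0.
Proof. exact: sigma_algebra0. Qed.

Let mx_measurableC A : mx_measurable A -> mx_measurable (~` A).
Proof. exact: sigma_algebraC. Qed.

Let mx_measurable_bigcup (F : (set 'M[T]_(m, n))^nat) :
  (forall i, mx_measurable (F i)) -> mx_measurable (\bigcup_i F i).
Proof. exact: sigma_algebra_bigcup. Qed.

HB.instance Definition _ := @isMeasurable.Build
  (mx_display d) 'M[T]_(m, n) mx_measurable
  mx_measurable0 mx_measurableC mx_measurable_bigcup.

End mx_measurable.

Section measurability.

Lemma measurable_Re (R : realType) :
  measurable_fun [set: R[i]] (@complex.Re R).
Proof.
move=> _ Y mY; apply: sub_sigma_algebra; left.
by exists Y.
Qed.

Lemma measurable_Im (R : realType) :
  measurable_fun [set: R[i]] (@complex.Im R).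
Proof.
move=> _ Y mY; apply: sub_sigma_algebra; right.
by exists Y.
Qed.

Lemma measurable_fun_complexP d (T : measurableType d) (R : realType)
    (f : T -> R[i]) :
  measurable_fun [set: T] f <->
  measurable_fun [set: T] (@complex.Re R \o f) /\
  measurable_fun [set: T] (@complex.Im R \o f).
Proof.
split=> [mf|[mRe mIm]].
  by split; apply: measurableT_comp => //;
    [exact: measurable_Re|exact: measurable_Im].
have H : g_sigma_preimageU (@complex.Re R \o f) (@complex.Im R \o f)
    `<=` measurable.
  apply: smallest_sub; first exact: sigma_algebra_measurable.
  by move=> A [] [B mB <-]; [exact: mRe|exact: mIm].
move=> _ A mA; apply: H; rewrite g_sigma_preimageU_comp.
by exists A.
Qed.

Lemma measurable_mx_entry d (T : measurableType d) m n (i : 'I_m) (j : 'I_n) :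
  measurable_fun [set: 'M[T]_(m, n)] (fun A : 'M[T]_(m, n) => A i j).
Proof.
move=> _ Y mY; apply: sub_sigma_algebra; exists (i, j) => //.
by exists Y.
Qed.

Lemma measurable_fun_mxP d d' (T : measurableType d) (T' : measurableType d')
    m n (f : T -> 'M[T']_(m, n)) :
  measurable_fun [set: T] f <->
  forall i j, measurable_fun [set: T] (fun t => f t i j).
Proof.
split=> [mf i j|mf].
  by apply: (measurableT_comp (@measurable_mx_entry _ _ m n i j)).
have : @mx_measurable _ T' m n `<=` image_set_system [set: T] f measurable.
  apply: smallest_sub; first exact/sigma_algebra_image/sigma_algebra_measurable.
  move=> _ [[i j] _ [B mB <-]]; rewrite /image_set_system/= !setTI.
  by rewrite -[X in measurable X]setTI; exact: (mf i j).
by move=> H _ A /H; rewrite /image_set_system/=.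
Qed.

End measurability.

Lemma sigma_finite_pushforward d1 d2 (T1 : measurableType d1)
    (T2 : measurableType d2) (R : realType)
    (mu : set T1 -> \bar R) (f : T1 -> T2) (g : T2 -> T1) :
  sigma_finite [set: T1] mu -> measurable_fun [set: T2] g -> cancel f g ->
  sigma_finite [set: T2] (pushforward mu f).
Proof.
move=> [F FT Foo] mg fK.
exists (fun k => g @^-1` F k); first by rewrite -preimage_bigcup -FT preimage_setT.
move=> k; split; first by rewrite -[X in measurable X]setTI; apply: mg; case: (Foo k).
rewrite /pushforward -comp_preimage (_ : g \o f = id) ?preimage_id.
  by case: (Foo k).
exact/funext.
Qed.

(* The sigma-finite structure that the library declares on [m1 \x m2] is not
   found by unification (an instance on subprobabilities shadows it). *)
Lemma sigma_finite_product d1 d2 (T1 : measurableType d1)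
    (T2 : measurableType d2) (R : realType)
    (m1 : {sigma_finite_measure set T1 -> \bar R})
    (m2 : {sigma_finite_measure set T2 -> \bar R}) :
  sigma_finite [set: T1 * T2] (m1 \x m2)%E.
Proof.
have /sigma_finiteP[F [TF ndF Foo]] := sigma_finiteT m1.
have /sigma_finiteP[G [TG ndG Goo]] := sigma_finiteT m2.
exists (fun n => F n `*` G n).
  rewrite -setXTT TF TG predeqE => -[x y]; split.
    move=> [/= [n _ Fnx] [k _ Gky]]; exists (maxn n k) => //; split.
    - by move: x Fnx; exact/subsetPset/ndF/leq_maxl.
    - by move: y Gky; exact/subsetPset/ndG/leq_maxr.
  by move=> [n _ []/= ? ?]; split; exists n.
move=> k; have [? ?] := Foo k; have [? ?] := Goo k.
split; first exact: measurableX.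
by rewrite product_measure1E// lte_mul_pinfty// ge0_fin_numE.
Qed.

Section cons_measure.
Context d (T : measurableType d) (R : realType) (n : nat).
Variables (mu : {sigma_finite_measure set T -> \bar R})
  (nu : {sigma_finite_measure set (n.-tuple T) -> \bar R}).

Definition cons_pair (x : T * n.-tuple T) : n.+1.-tuple T :=
  [the n.+1.-tuple T of x.1 :: x.2].

Lemma measurable_cons_pair :
  measurable_fun [set: T * n.-tuple T] cons_pair.
Proof. exact: measurable_cons. Qed.

Definition cons_measure : set (n.+1.-tuple T) -> \bar R :=
  pushforward (mu \x nu)%E cons_pair.

Let cons_measure0 : cons_measure set0 = 0%E.
Proof. by rewrite /cons_measure /pushforward preimage_set0 measure0. Qed.

Let cons_measure_ge0 A : (0 <= cons_measure A)%E.
Proof. by rewrite /cons_measure /pushforward measure_ge0. Qed.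

Let cons_measure_sigma_additive : semi_sigma_additive cons_measure.
Proof.
move=> F mF tF mUF; apply: (@measure_semi_sigma_additive _ _ _
  (pushforward (mu \x nu)%E cons_pair)) => //; exact: measurable_cons_pair.
Qed.

HB.instance Definition _ := isMeasure.Build _ _ _ cons_measure
  cons_measure0 cons_measure_ge0 cons_measure_sigma_additive.

Let cons_measure_sigma_finite : sigma_finite [set: n.+1.-tuple T] cons_measure.
Proof.
pose uncons (t : n.+1.-tuple T) : T * n.-tuple T :=
  (thead t, [tuple of behead t]).
have muncons : measurable_fun [set: n.+1.-tuple T] uncons.
  apply/measurable_fun_pair; first exact: measurable_tnth.
  exact: measurable_behead.
have consK : cancel cons_pair uncons.
  by move=> [x t]; congr pair; apply/val_inj.
exact: (sigma_finite_pushforward (sigma_finite_product mu nu) muncons consK).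
Qed.

HB.instance Definition _ := Measure_isSigmaFinite.Build _ _ _ cons_measure
  cons_measure_sigma_finite.

End cons_measure.

Fixpoint power_measure d (T : measurableType d) (R : realType)
    (mu : {sigma_finite_measure set T -> \bar R}) (n : nat) :
    {sigma_finite_measure set (n.-tuple T) -> \bar R} :=
  match n with
  | 0%N => \d_([tuple] : 0.-tuple T)
  | n'.+1 => cons_measure mu (power_measure mu n')
  end.

Section complex_lebesgue_measure.
Context (R : realType).

Definition complex_of_pair (z : R * R) : R[i] := z.1 +i* z.2.

Lemma measurable_complex_of_pair :
  measurable_fun [set: R * R] complex_of_pair.
Proof.
apply/measurable_fun_complexP; split.
  exact: (@measurable_fst _ _ R R).
exact: (@measurable_snd _ _ R R).
Qed.

Definition complex_lebesgue_measure : set R[i] -> \bar R :=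
  pushforward (@lebesgue_measure R \x @lebesgue_measure R)%E complex_of_pair.

Let complex_lebesgue_measure0 : complex_lebesgue_measure set0 = 0%E.
Proof.
by rewrite /complex_lebesgue_measure /pushforward preimage_set0 measure0.
Qed.

Let complex_lebesgue_measure_ge0 A : (0 <= complex_lebesgue_measure A)%E.
Proof. by rewrite /complex_lebesgue_measure /pushforward measure_ge0. Qed.

Let complex_lebesgue_measure_sigma_additive :
  semi_sigma_additive complex_lebesgue_measure.
Proof.
move=> F mF tF mUF; apply: (@measure_semi_sigma_additive _ _ _
  (pushforward (@lebesgue_measure R \x @lebesgue_measure R)%E
    complex_of_pair)) => //; exact: measurable_complex_of_pair.
Qed.

HB.instance Definition _ := isMeasure.Build _ _ _ complex_lebesgue_measure
  complex_lebesgue_measure0 complex_lebesgue_measure_ge0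
  complex_lebesgue_measure_sigma_additive.

Let complex_lebesgue_measure_sigma_finite :
  sigma_finite [set: R[i]] complex_lebesgue_measure.
Proof.
apply: (@sigma_finite_pushforward _ _ _ _ _ _ _
  (fun z : R[i] => (complex.Re z, complex.Im z))).
- exact: (sigma_finite_product (@lebesgue_measure R) (@lebesgue_measure R)).
- by apply/measurable_fun_pair; [exact: measurable_Re|exact: measurable_Im].
- by move=> [].
Qed.

HB.instance Definition _ := Measure_isSigmaFinite.Build _ _ _
  complex_lebesgue_measure complex_lebesgue_measure_sigma_finite.

End complex_lebesgue_measure.
Arguments complex_lebesgue_measure {R}.

Section mx_lebesgue_measure.
Context (R : realType) (m n : nat).

Let rows_measure :
    {sigma_finite_measure set (m.-tuple (n.-tuple R[i])) -> \bar R} :=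
  power_measure (power_measure (@complex_lebesgue_measure R) n) m.

Definition mx_of_rows (t : m.-tuple (n.-tuple R[i])) : 'M[R[i]]_(m, n) :=
  \matrix_(i, j) tnth (tnth t i) j.

Lemma measurable_mx_of_rows :
  measurable_fun [set: m.-tuple (n.-tuple R[i])] mx_of_rows.
Proof.
apply/measurable_fun_mxP => i j; under eq_fun do rewrite mxE.
apply: (@measurableT_comp _ _ _ _ _ _ (fun t : n.-tuple R[i] => tnth t j)).
  exact: measurable_tnth.
exact: measurable_tnth.
Qed.

Definition mx_lebesgue_measure : set 'M[R[i]]_(m, n) -> \bar R :=
  pushforward rows_measure mx_of_rows.

Let mx_lebesgue_measure0 : mx_lebesgue_measure set0 = 0%E.
Proof. by rewrite /mx_lebesgue_measure /pushforward preimage_set0 measure0. Qed.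

Let mx_lebesgue_measure_ge0 A : (0 <= mx_lebesgue_measure A)%E.
Proof. by rewrite /mx_lebesgue_measure /pushforward measure_ge0. Qed.

Let mx_lebesgue_measure_sigma_additive :
  semi_sigma_additive mx_lebesgue_measure.
Proof.
move=> F mF tF mUF; apply: (@measure_semi_sigma_additive _ _ _
  (pushforward rows_measure mx_of_rows)) => //; exact: measurable_mx_of_rows.
Qed.

HB.instance Definition _ := isMeasure.Build _ _ _ mx_lebesgue_measure
  mx_lebesgue_measure0 mx_lebesgue_measure_ge0
  mx_lebesgue_measure_sigma_additive.

Let mx_lebesgue_measure_sigma_finite :
  sigma_finite [set: 'M[R[i]]_(m, n)] mx_lebesgue_measure.
Proof.
apply: (@sigma_finite_pushforward _ _ _ _ _ _ _
  (fun A : 'M[R[i]]_(m, n) => [tuple [tuple A i j | j < n] | i < m])).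
- exact: sigma_finiteT.
- apply/measurable_fun_tnthP => i; apply/measurable_fun_tnthP => j.
  rewrite (_ : _ \o _ = fun A : 'M[R[i]]_(m, n) => A i j).
    exact: measurable_mx_entry.
  by apply/funext => A /=; rewrite !tnth_mktuple.
- move=> t; apply/eq_from_tnth => i; apply/eq_from_tnth => j.
  by rewrite !tnth_mktuple mxE.
Qed.

HB.instance Definition _ := Measure_isSigmaFinite.Build _ _ _
  mx_lebesgue_measure mx_lebesgue_measure_sigma_finite.

End mx_lebesgue_measure.
Arguments mx_lebesgue_measure {R m n}.

Definition has_density d d' (Omega : measurableType d) (T : measurableType d')
    (R : realType) (P : probability Omega R) (X : {RV P >-> T})
    (mu : {measure set T -> \bar R}) (f : T -> R) : Prop :=
  [/\ measurable_fun [set: T] f, forall x, 0 <= f x &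
      forall A, measurable A ->
        distribution P X A = (\int[mu]_(x in A) (f x)%:E)%E].

Definition has_law d d' (Omega : measurableType d) (T : measurableType d')
    (R : realType) (P : probability Omega R) (X : Omega -> T)
    (nu : set T -> \bar R) : Prop :=
  measurable_fun [set: Omega] X /\
  forall A, measurable A -> P (X @^-1` A) = nu A.

(* The law of [b^-1] for [b] of law [nu]. It is a law on [R[i]] because the
   ratio of Cramer-Rao bounds is a quotient of entries of complex matrices. *)
Definition inverse_law (R : realType) (nu : set (measurableTypeR R) -> \bar R) :
    set R[i] -> \bar R :=
  pushforward nu (fun b : R => (b^-1)%:C).

(* Derivatives are taken on real and imaginary parts because [R[i]] carries no
   canonical structure of normed module over [R]. *)
Definition is_partial_derive (R : realType) (n p : nat)
    (x : 'rV[R]_p -> 'cV[R[i]]_n) (theta : 'rV[R]_p) (i : 'I_p)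
    (v : 'cV[R[i]]_n) : Prop :=
  forall k : 'I_n,
    is_derive theta (delta_mx 0 i) (fun t => complex.Re (x t k 0) : R)
      (complex.Re (v k 0)) /\
    is_derive theta (delta_mx 0 i) (fun t => complex.Im (x t k 0) : R)
      (complex.Im (v k 0)).

Section fisher.
Context (R : realType) (n m p : nat).
Implicit Types (G : 'M[R[i]]_(n, p)) (Phi : 'M[R[i]]_(m, n)).

(* The orthogonal projection onto the range of [Phi ^t*] when [Phi *m Phi ^t*]
   is invertible. *)
Definition proj_adj Phi : 'M[R[i]]_n :=
  Phi ^t* *m invmx (Phi *m Phi ^t*) *m Phi.

(* Fisher information about [theta] carried by y ~ CN(x(theta), sigma2 I), resp.
   by [Phi *m y] ~ CN(Phi x(theta), sigma2 Phi Phi^H), where [G] is the Jacobian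
   of x at [theta]; the convention is the one that keeps the complex Hermitian
   matrix [G ^t* *m G], not twice its real part. *)
Definition fisher (sigma2 : R) G : 'M[R[i]]_p :=
  (sigma2^-1)%:C *: (G ^t* *m G).

Definition fisher_compressed (sigma2 : R) Phi G : 'M[R[i]]_p :=
  (sigma2^-1)%:C *: (G ^t* *m proj_adj Phi *m G).

End fisher.

Definition cramer_rao (R : realType) (p : nat) (J : 'M[R[i]]_p) (i : 'I_p) : R[i] :=
  invmx J i i.

(* Main.v *)
Require Import Defs.
From HB Require Import structures.
From mathcomp Require Import all_boot all_order all_algebra.
From mathcomp Require Import all_classical all_reals all_analysis.
From mathcomp Require Import measurable_realfun complex ring lra zify.

Set Implicit Arguments.
Unset Strict Implicit.
Unset Printing Implicit Defensive.

Import Order.TTheory GRing.Theory Num.Theory.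
Import numFieldNormedType.Exports.

Local Open Scope classical_set_scope.
Local Open Scope ring_scope.
Local Open Scope complex_scope.
Local Open Scope sesquilinear_scope.

(* Write the ratio of the bounds as |v|^2 / <v, Q v>, where v is the component
   of the i-th column of G orthogonal to the other columns X, in coordinates of
   the orthogonal complement of X, and Q is the orthogonal projector, of rank
   m - p + 1, onto the part of the row space of Phi orthogonal to X (Schur
   complements). Lebesgue measure on matrices is unitarily invariant, because
   translation-invariant sigma-finite measures are proportional; hence the law
   of the ratio does not depend on v <> 0, and v may be taken uniform in the
   unit ball of C^(n-p+1). Conditionally on Phi the inverse ratio is then
   distributed as |v_1|^2 / |v|^2 with v_1 the first m - p + 1 coordinates of v.
   As the volume of a ball of C^k is proportional to r^k in terms of the squared
   radius r, this is the law of a / (a + b) when (a, b) has density proportional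
   to a^(m-p) b^(n-m-1) on a + b <= 1, i.e. B(m - p + 1, n - m). *)

(** * Adjoints and orthogonal projectors *)

(** Averaging over [v] replaces an integral over the unitary group: no Haar measure is built, and
    single vectors are moved by explicit unitary matrices. The average is undone by dividing by the
    volume of the set of vectors, so this set must be unitarily invariant with finite positive
    volume; the unit ball qualifies, and its origin is removed because the ratio is 0/0 there.

    The algebraic identities hold when [Z Z^H], [X^H P X] and [G^H P G] are invertible, whereas
    [invmx] is total. The exceptional [Z] lie in zero sets of determinants [\det (E *m Z *m F)],
    which are Lebesgue-null, so they disappear under the integral. Besides being a density,
    [f Z = g (Z Z^H)] contributes its total mass 1 and its invariance under [Z -> Z U].

    The volume of the ball is never computed. Each unknown constant is removed by evaluating both
    sides on one set: the unit cube for proportional measures, the unit ball for isometries, the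
    whole line for the beta law. *)

Section adjoint.
Variable C : numClosedFieldType.

Lemma trmxCM m n p (A : 'M[C]_(m, n)) (B : 'M[C]_(n, p)) :
  (A *m B) ^t* = B ^t* *m A ^t*.
Proof. by rewrite trmx_mul map_mxM. Qed.

Lemma trmxCD m n (A B : 'M[C]_(m, n)) : (A + B) ^t* = A ^t* + B ^t*.
Proof. by rewrite linearD map_mxD. Qed.

Lemma trmxCB m n (A B : 'M[C]_(m, n)) : (A - B) ^t* = A ^t* - B ^t*.
Proof. by rewrite linearB map_mxB. Qed.

Lemma trmxCZ m n (a : C) (A : 'M[C]_(m, n)) : (a *: A) ^t* = Num.conj a *: A
  ^t*.
Proof. by rewrite linearZ map_mxZ. Qed.

Lemma trmxC1 n : (1%:M : 'M[C]_n) ^t* = 1%:M.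
Proof. by rewrite trmx1 map_mx1. Qed.

Lemma trmxC_inv n (A : 'M[C]_n) : (invmx A) ^t* = invmx (A ^t*).
Proof. by rewrite trmx_inv map_invmx. Qed.

Lemma gram_eq0 m n (A : 'M[C]_(m, n)) : A ^t* *m A = 0 -> A = 0.
Proof.
move=> AA0; apply/matrixP => i j; rewrite mxE.
have : (A ^t* *m A) j j = 0 by rewrite AA0 mxE.
rewrite mxE => /eqP; rewrite psumr_eq0; last first.
  by move=> k _; rewrite !mxE mulrC mul_conjC_ge0.
move=> /allP /(_ i (mem_index_enum i)); rewrite !mxE mulrC mul_conjC_eq0.
by move=> /eqP.
Qed.

(** [A^H A w = 0] forces [A w = 0], and the left inverse [B] then gives [w = 0]. Full column rank is
    used below in this form, as an explicit left inverse. *)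
Lemma inv_gram_unit m n (A : 'M[C]_(m, n)) (B : 'M[C]_(n, m)) :
  B *m A = 1%:M -> A ^t* *m A \in unitmx.
Proof.
move=> BA; rewrite -unitmx_tr -row_free_unit -kermx_eq0.
apply/eqP/(can_inj (@trmxK _ _ _)); rewrite trmx0.
set K := kermx _.
have K0 : (A ^t* *m A) *m K^T = 0.
  by apply/(can_inj (@trmxK _ _ _)); rewrite trmx_mul trmxK mulmx_ker trmx0.
have /gram_eq0 AK0 : (A *m K^T) ^t* *m (A *m K^T) = 0.
  by rewrite trmxCM -mulmxA (mulmxA (A ^t*)) K0 mulmx0.
by rewrite -[K^T]mul1mx -BA -mulmxA AK0 mulmx0.
Qed.

(** Gram-Schmidt on a row basis of [Q] yields [B]. Its number of rows is the rank of [Q], which is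
    identified with the trace because the trace is what cyclicity computes for residual
    projectors. *)
Lemma proj_onb k n (Q : 'M[C]_n) : Q ^t* = Q -> Q *m Q = Q ->
  \tr Q = k%:R -> exists2 B : 'M[C]_(k, n), B *m B ^t* = 1%:M & Q = B ^t* *m B.
Proof.
move=> Qadj Qid trQ.
have [r [B BB eqB]] :
    exists r, exists2 B : 'M[C]_(r, n), B *m B ^t* = 1%:M & (B :=: Q)%MS.
  exists (\rank Q), (schmidt (row_base Q)).
    by apply/unitarymxP/schmidt_unitarymx/rank_leq_col.
  apply: eqmx_trans (eq_row_base Q).
  by apply: eqmx_schmidt_free; exact: row_base_free.
have BQ : B *m Q = B.
  have /submxP [D ->] : (B <= Q)%MS by rewrite eqB.
  by rewrite -mulmxA Qid.
have QB : Q *m B ^t* *m B = Q.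
  have /submxP [D ->] : (Q <= B)%MS by rewrite eqB.
  by rewrite -(mulmxA D) BB mulmx1.
have QE : Q = B ^t* *m B by rewrite -{1}QB -{1}Qadj -trmxCM BQ.
suff <- : r = k by exists B.
by apply/eqP; rewrite -(eqr_nat C) -trQ QE mxtrace_mulC BB mxtrace1.
Qed.

(* The map [I - x x^H / (x^H u)] with [x = u - v] sends [u] to [v], and it is
   unitary because [x^H u + u^H x = x^H x] when [u] and [v] have equal norms. *)
Lemma unitary_transitive n (u v : 'cV[C]_n) : u ^t* *m u = v ^t* *m v ->
  exists2 U : 'M[C]_n, U ^t* *m U = 1%:M & U *m u = v.
Proof.
move=> uv; pose x := u - v; pose a := (x ^t* *m u) 0 0.
have aE : x ^t* *m u = a%:M by exact: mx11_scalar.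
have aE' : u ^t* *m x = (Num.conj a)%:M.
  by rewrite -[LHS](trmxCK) trmxCM trmxCK aE tr_scalar_mx map_scalar_mx.
have xx : x ^t* *m x = (a + Num.conj a)%:M.
  have -> : (a + Num.conj a)%:M = x ^t* *m u + u ^t* *m x :> 'M[C]_(1, 1).
    by rewrite aE aE' raddfD.
  rewrite /x trmxCB !mulmxBl !mulmxBr uv.
  move: (v ^t* *m v) (v ^t* *m u) (u ^t* *m v) => vv vu uv'.
  by apply/matrixP => i j; rewrite !mxE; ring.
have [x0|x0] := eqVneq x 0.
  exists 1%:M; first by rewrite trmxC1 mulmx1.
  by rewrite mul1mx; apply/subr0_eq.
have a0 : a != 0.
  apply: contra_neq x0 => a0; apply: gram_eq0.
  by rewrite xx a0 rmorph0 addr0 raddf0.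
have b0 : Num.conj a != 0 by rewrite conjC_eq0.
exists (1%:M - a^-1 *: (x *m x ^t*)).
  rewrite trmxCB trmxC1 trmxCZ trmxCM trmxCK mulmxBl mul1mx mulmxBr mulmx1.
  rewrite -!scalemxAl -!scalemxAr -(mulmxA x) (mulmxA (x ^t*)) xx mul_scalar_mx.
  rewrite -scalemxAr fmorphV; move: (x *m x ^t*) (1%:M : 'M[C]_n) => E I1.
  by apply/matrixP => i j; rewrite !mxE; field; rewrite a0 b0.
rewrite mulmxBl mul1mx -scalemxAl -mulmxA aE mul_mx_scalar scalerA mulVf//.
by rewrite scale1r /x opprB addrC subrK.
Qed.

End adjoint.

(** * Residual projectors and Schur complements *)

Section residual.
Variable C : numClosedFieldType.

(* If [P] is the orthogonal projector onto V, then [resid P X] is the orthogonal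
   projector onto the orthogonal complement of [X] in V. *)
Definition resid n q (P : 'M[C]_n) (X : 'M[C]_(n, q)) : 'M[C]_n :=
  P - P *m X *m invmx (X ^t* *m P *m X) *m X ^t* *m P.

Section properties.
Variables (n q : nat) (P : 'M[C]_n) (X : 'M[C]_(n, q)).

Lemma resid_trmxC : P ^t* = P -> (resid P X) ^t* = resid P X.
Proof.
by move=> Padj; rewrite trmxCB !trmxCM trmxC_inv !trmxCM !trmxCK Padj !mulmxA.
Qed.

Lemma resid_conj (U : 'M[C]_n) :
  U *m X = X -> resid (U ^t* *m P *m U) X = U ^t* *m resid P X *m U.
Proof.
move=> UX; have XU : X ^t* *m U ^t* = X ^t* by rewrite -trmxCM UX.
have UPX : U ^t* *m P *m U *m X = U ^t* *m P *m X by rewrite -mulmxA UX.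
have XPU : X ^t* *m (U ^t* *m P *m U) = X ^t* *m P *m U by rewrite !mulmxA XU.
have XPX : X ^t* *m P *m U *m X = X ^t* *m P *m X by rewrite -mulmxA UX.
rewrite /resid UPX -[in X in _ - X]mulmxA XPU XPX.
by rewrite mulmxBr mulmxBl !mulmxA.
Qed.

Hypothesis XPX : X ^t* *m P *m X \in unitmx.

Lemma residX : resid P X *m X = 0.
Proof.
rewrite /resid; have := mulVmx XPX; move: (invmx _) => J.
by rewrite mulmxBl -!mulmxA => ->; rewrite mulmx1 subrr.
Qed.

Lemma resid_trX : P ^t* = P -> X ^t* *m resid P X = 0.
Proof. by move=> Padj; rewrite -(resid_trmxC Padj) -trmxCM residX trmx0
  map_mx0. Qed.

(** The term subtracted in [resid 1%:M X] starts with [X], which [resid P X] kills. Once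
    [resid 1%:M X = W W^H] is known, this lets [W W^H] be absorbed. *)
Lemma resid_sub : resid P X *m resid 1%:M X = resid P X.
Proof.
by rewrite {2}/resid mulmxBr !mulmxA !mulmx1 residX !mul0mx subr0.
Qed.

Hypotheses (Padj : P ^t* = P) (Pid : P *m P = P).

Lemma resid_mull : resid P X *m P = resid P X.
Proof. by rewrite /resid mulmxBl Pid -(mulmxA _ P P) Pid. Qed.

Lemma resid_idem : resid P X *m resid P X = resid P X.
Proof.
rewrite {2}/resid mulmxBr resid_mull.
by rewrite !mulmxA resid_mull residX !mul0mx subr0.
Qed.

Lemma tr_resid : \tr (resid P X) = \tr P - q%:R.
Proof.
rewrite linearB /=; congr (_ - _).
rewrite -(mulmxA _ _ P) mxtrace_mulC !mulmxA -(mulmxA _ P P) Pid.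
by rewrite mulmxV// mxtrace1.
Qed.

End properties.

(** Solving [K c = a e_i] with [c_i = 1] reads off one diagonal entry of the inverse, so no block
    decomposition or permutation of indices is required. *)
Lemma invmx_diag_entry p (K : 'M[C]_p) (c : 'cV[C]_p) (i : 'I_p) (a : C) :
  K \in unitmx -> c i 0 = 1 -> K *m c = a *: delta_mx i 0 ->
  a != 0 /\ invmx K i i = a^-1.
Proof.
move=> Ku ci Kc.
have e : 1 = a * invmx K i i.
  by rewrite -ci -[c](mulKmx Ku) Kc -scalemxAr mxE -colE mxE.
have a0 : a != 0 by apply: contra_eq_neq e => ->; rewrite mul0r oner_eq0.
by split=> //; rewrite -[LHS](mulKf a0) -e mulr1.
Qed.

Lemma invmx_gram_diag n p (P : 'M[C]_n) (G : 'M[C]_(n, p)) (i : 'I_p)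
    (X := col' i G) (g := col i G) :
  P ^t* = P -> G ^t* *m P *m G \in unitmx -> X ^t* *m P *m X \in unitmx ->
  (g ^t* *m resid P X *m g) 0 0 != 0 /\
  invmx (G ^t* *m P *m G) i i = ((g ^t* *m resid P X *m g) 0 0)^-1.
Proof.
move=> Padj Ku Xu.
pose E : 'M[C]_(p, p.-1) := col' i 1%:M.
have XE : X = G *m E by rewrite /X /E !col'Esub mulmx_colsub mulmx1.
have gE : g = G *m delta_mx i 0 by rewrite -colE.
(* Minus the regression coefficients of [g] on [X] for the form defined by [P]: with
   [c = e_i + E d], the vector [G c] is the residual of [g]. *)
pose d := - (invmx (X ^t* *m P *m X) *m X ^t* *m P *m g).
apply: (@invmx_diag_entry _ _ (delta_mx i 0 + E *m d)) => //.
  rewrite !mxE !eqxx big1 ?addr0// => k _.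
  by rewrite !mxE (negPf (neq_lift _ _)) mul0r.
have -> : G ^t* *m P *m G *m (delta_mx i 0 + E *m d) = G ^t* *m resid P X *m g.
  rewrite mulmxDr -!(mulmxA _ G) -gE (mulmxA G) -XE /d mulmxN mulmxN.
  rewrite /resid mulmxBr mulmxBl; congr (_ - _).
  by rewrite !mulmxA.
(* Entry [i] is the quadratic form in [g]; the others vanish because [X^H resid P X = 0]. *)
apply/matrixP => j j'; rewrite ord1 [RHS]mxE [delta_mx _ _ _ _]mxE eqxx andbT.
have [k ->|->] := unliftP i j; last first.
  rewrite eqxx mulr1 !mxE; apply: eq_bigr => k _; congr (_ * _).
  by rewrite !mxE; apply: eq_bigr => k' _; rewrite !mxE.
rewrite eq_sym (negPf (neq_lift _ _)) mulr0.
have : (X ^t* *m resid P X *m g) k 0 = 0 by rewrite resid_trX// mul0mx mxE.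
rewrite mxE => <-; rewrite mxE; apply: eq_bigr => l _; congr (_ * _).
by rewrite !mxE; apply: eq_bigr => k' _; rewrite !mxE.
Qed.

End residual.

(** * The ratio of Cramer-Rao bounds *)

Section compression.
Variable R : realType.
Local Notation C := R[i].

Definition normsq m n (Z : 'M[C]_(m, n)) : R :=
  \sum_i \sum_j (complex.Re (Z i j) ^+ 2 + complex.Im (Z i j) ^+ 2).

Lemma normsq_ge0 m n (Z : 'M[C]_(m, n)) : 0 <= normsq Z.
Proof. by do 2 (apply: sumr_ge0 => ? _); rewrite addr_ge0 ?sqr_ge0. Qed.

Lemma mul_conj_normsq (z : C) :
  Num.conj z * z = (complex.Re z ^+ 2 + complex.Im z ^+ 2)%:C.
Proof. rewrite -[Num.conj z]/(z^*)%C; case: z => x y; simpc; congr (_ +i* _);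
  rewrite /=; ring. Qed.

Lemma normsq_entry_le m n (Z : 'M[C]_(m, n)) i j :
  complex.Re (Z i j) ^+ 2 + complex.Im (Z i j) ^+ 2 <= normsq Z.
Proof.
have sq_ge0 k l : 0 <= complex.Re (Z k l) ^+ 2 + complex.Im (Z k l) ^+ 2.
  by rewrite addr_ge0 ?sqr_ge0.
rewrite /normsq (bigD1 i)//= (bigD1 j)//= -addrA lerDl.
by rewrite addr_ge0 ?sumr_ge0// => k _; rewrite sumr_ge0.
Qed.

Lemma normsq_gram n (v : 'cV[C]_n) : v ^t* *m v = ((normsq v)%:C)%:M.
Proof.
rewrite [LHS]mx11_scalar; congr _%:M; rewrite mxE /normsq rmorph_sum.
by apply: eq_bigr => i _; rewrite big_ord1 !mxE mul_conj_normsq.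
Qed.

Lemma normsq_eq0 n (v : 'cV[C]_n) : (normsq v == 0) = (v == 0).
Proof.
apply/eqP/eqP => [v0|->]; last first.
  by rewrite /normsq big1// => i _; rewrite big1// => j _;
    rewrite mxE /= expr0n addr0.
by apply: gram_eq0; rewrite normsq_gram v0 raddf0.
Qed.

Lemma normsq_gt0 n (v : 'cV[C]_n) : (0 < normsq v) = (v != 0).
Proof. by rewrite lt0r normsq_ge0 andbT normsq_eq0. Qed.

Lemma normsqZ m n (a : R) (Z : 'M[C]_(m, n)) :
  normsq (a%:C *: Z) = a ^+ 2 * normsq Z.
Proof.
rewrite /normsq mulr_sumr; apply: eq_bigr => i _.
rewrite mulr_sumr; apply: eq_bigr => j _; rewrite mxE.
by case: (Z i j) => x y /=; ring.
Qed.

Lemma normsq_unitary n p (U : 'M[C]_(p, n)) (v : 'cV[C]_n) : U ^t* *m U = 1%:M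
  ->
  normsq (U *m v) = normsq v.
Proof.
move=> UU; have := normsq_gram (U *m v).
rewrite trmxCM mulmxA -(mulmxA _ _ U) UU mulmx1 normsq_gram.
by move=> /matrixP /(_ 0 0); rewrite !mxE eqxx => -[->].
Qed.

Lemma normsq_tr m n (Z : 'M[C]_(m, n)) : (normsq Z)%:C = \tr (Z *m Z ^t*).
Proof.
rewrite /normsq rmorph_sum; apply: eq_bigr => i _; rewrite mxE rmorph_sum.
by apply: eq_bigr => j _; rewrite !mxE mulrC mul_conj_normsq.
Qed.

Lemma normsq_mulr_unitary m n (U : 'M[C]_n) (Z : 'M[C]_(m, n)) : U *m U ^t* =
  1%:M ->
  normsq (Z *m U) = normsq Z.
Proof.
move=> UU; apply: (@complexI R); rewrite !normsq_tr trmxCM.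
by rewrite mulmxA -(mulmxA Z) UU mulmx1.
Qed.

Lemma normsq_col_mx k l (v : 'cV[C]_k) (w : 'cV[C]_l) :
  normsq (col_mx v w) = normsq v + normsq w.
Proof.
rewrite /normsq big_split_ord /=; congr (_ + _); apply: eq_bigr => i _.
  by apply: eq_bigr => j _; rewrite col_mxEu.
by apply: eq_bigr => j _; rewrite col_mxEd.
Qed.

Section projection.
Variables (m n : nat) (Z : 'M[C]_(m, n)).

Lemma proj_adj_trmxC : (proj_adj Z) ^t* = proj_adj Z.
Proof.
by rewrite /proj_adj !trmxCM trmxC_inv trmxCM !trmxCK mulmxA.
Qed.

Lemma proj_adjMr (U : 'M[C]_n) : U *m U ^t* = 1%:M ->
  proj_adj (Z *m U) = U ^t* *m proj_adj Z *m U.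
Proof.
move=> UU; rewrite /proj_adj !trmxCM (mulmxA (Z *m U)) -(mulmxA Z) UU mulmx1.
by rewrite !mulmxA.
Qed.

Hypothesis ZZ : Z *m Z ^t* \in unitmx.

Lemma mul_proj_adj : Z *m proj_adj Z = Z.
Proof. by rewrite /proj_adj !mulmxA mulmxV// mul1mx. Qed.

Lemma proj_adj_idem : proj_adj Z *m proj_adj Z = proj_adj Z.
Proof. by rewrite {1}/proj_adj -(mulmxA _ Z) mul_proj_adj. Qed.

Lemma tr_proj_adj : \tr (proj_adj Z) = m%:R.
Proof.
by rewrite /proj_adj mxtrace_mulC mulmxA mulmxV// mxtrace1.
Qed.

Lemma compressed_gram_unit p (F : 'M[C]_(n, p)) (Y : 'M[C]_(p, m)) :
  Y *m Z *m F = 1%:M -> F ^t* *m proj_adj Z *m F \in unitmx.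
Proof.
move=> YZF; have <- : (proj_adj Z *m F) ^t* *m (proj_adj Z *m F) =
    F ^t* *m proj_adj Z *m F.
  by rewrite trmxCM proj_adj_trmxC mulmxA -(mulmxA _ (proj_adj Z) (proj_adj Z))
    proj_adj_idem.
apply: (@inv_gram_unit _ _ _ _ (Y *m Z)).
by rewrite mulmxA -(mulmxA Y) mul_proj_adj.
Qed.

End projection.

Section statistic.
Variables (n q N : nat) (X : 'M[C]_(n, q)) (W : 'M[C]_(n, N)).

Definition compressed_proj m (Z : 'M[C]_(m, n)) : 'M[C]_N :=
  W ^t* *m resid (proj_adj Z) X *m W.

(* The ratio of Cramer-Rao bounds when the component of the i-th column of [G]
   orthogonal to the other columns [X] is [W *m v]. *)
Definition crb_ratio m (Z : 'M[C]_(m, n)) (v : 'cV[C]_N) : C :=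
  (normsq v)%:C / (v ^t* *m compressed_proj Z *m v) 0 0.

Lemma crb_ratioZ m (Z : 'M[C]_(m, n)) (a : R) (v : 'cV[C]_N) : a != 0 ->
  crb_ratio Z (a%:C *: v) = crb_ratio Z v.
Proof.
move=> a0; rewrite /crb_ratio normsqZ trmxCZ -!scalemxAl -!scalemxAr.
rewrite (_ : Num.conj a%:C = a%:C); last exact: conjc_real.
rewrite scalerA; move: (_ *m v) => D; rewrite mxE -expr2 rmorphM rmorphXn /=.
by rewrite invfM mulrACA divff ?mul1r// expf_neq0// (inj_eq (@complexI R)).
Qed.

Hypotheses (WW : W ^t* *m W = 1%:M) (WX : W ^t* *m X = 0).

(** A unitary matrix only relates vectors of equal norm, so [v] is first rescaled by [s], to which
    the ratio is insensitive. The motion of the vector is then transferred to [Z] through a unitary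
    matrix that fixes [X]. *)
Lemma crb_ratio_transitive m (v0 v : 'cV[C]_N) : v0 != 0 -> v != 0 ->
  exists2 U : 'M[C]_n, U *m U ^t* = 1%:M &
    forall Z : 'M[C]_(m, n), crb_ratio (Z *m U) v0 = crb_ratio Z v.
Proof.
move=> v00 vN0; have vp : 0 < normsq v by rewrite normsq_gt0.
pose s := Num.sqrt (normsq v0 / normsq v).
have s0 : s != 0 by rewrite gt_eqF// sqrtr_gt0 divr_gt0// normsq_gt0.
have [|U UU Uv] := @unitary_transitive _ _ v0 (s%:C *: v).
  rewrite !normsq_gram normsqZ sqr_sqrtr ?divr_ge0 ?normsq_ge0//.
  by rewrite divfK// gt_eqF.
(* [V] acts as [U] on the range of [W] and as the identity on its orthogonal complement, which
   contains [X]. *)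
pose V := 1%:M - W *m W ^t* + W *m U *m W ^t*.
have VW : V *m W = W *m U.
  by rewrite mulmxDl mulmxBl mul1mx -!mulmxA WW mulmx1 mulmx1 subrr add0r.
have VX : V *m X = X.
  by rewrite mulmxDl mulmxBl mul1mx -!mulmxA WX !mulmx0 subr0 addr0.
have WV : W ^t* *m V = U *m W ^t*.
  by rewrite mulmxDr mulmxBr mulmx1 !mulmxA WW !mul1mx subrr add0r.
have VV : V ^t* *m V = 1%:M.
  rewrite {1}/V trmxCD trmxCB trmxC1 !trmxCM !trmxCK mulmxDl mulmxBl mul1mx.
  rewrite -!mulmxA WV (mulmxA _ U) UU mul1mx /V -mulmxA.
  move: (W *m W ^t*) (W *m (U *m W ^t*)) => A B.
  by apply/matrixP => i j; rewrite !mxE; ring.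
have VV' : V *m V ^t* = 1%:M by apply: mulmx1C.
exists V => // Z; rewrite -(crb_ratioZ Z v s0) -Uv /crb_ratio normsq_unitary//.
congr (_ / _); rewrite /compressed_proj proj_adjMr// resid_conj//.
rewrite !mulmxA -(mulmxA _ V W) VW -(mulmxA _ (W ^t*) (V ^t*)) -trmxCM VW.
by rewrite !trmxCM !mulmxA.
Qed.

Hypothesis WWX : resid 1%:M X = W *m W ^t*.

(** The range of [resid (proj_adj Z) X] lies in the range of [W], so passing to the coordinates [W]
    preserves idempotence and the trace [m - q = k]. *)
Lemma compressed_proj_onb k l m (Z : 'M[C]_(m, n)) : N = (k + l)%N ->
  m = (k + q)%N -> Z *m Z ^t* \in unitmx ->
  X ^t* *m proj_adj Z *m X \in unitmx ->
  exists2 B : 'M[C]_(k, N), B *m B ^t* = 1%:M & compressed_proj Z = B ^t* *m B.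
Proof.
move=> Nkl mkq ZZ XZ.
pose S := resid (proj_adj Z) X.
have Pt := proj_adj_trmxC Z; have Pid := proj_adj_idem ZZ.
have St : S ^t* = S by exact: resid_trmxC.
have SW : S *m (W *m W ^t*) = S by rewrite -WWX; exact: (resid_sub XZ).
apply: proj_onb.
- by rewrite /compressed_proj -/S !trmxCM St trmxCK mulmxA.
- rewrite /compressed_proj -/S !mulmxA -(mulmxA _ W (W ^t*)).
  by rewrite -(mulmxA _ S (W *m _)) SW -(mulmxA _ S S) resid_idem.
- rewrite /compressed_proj -/S mxtrace_mulC mulmxA mxtrace_mulC SW tr_resid//.
  by rewrite tr_proj_adj// mkq natrD addrK.
Qed.

End statistic.

Lemma crb_ratio_unitary n q k l m (X : 'M[C]_(n, q)) (W : 'M[C]_(n, k + l))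
    (Z : 'M[C]_(m, n)) :
  resid 1%:M X = W *m W ^t* -> m = (k + q)%N ->
  Z *m Z ^t* \in unitmx -> X ^t* *m proj_adj Z *m X \in unitmx ->
  exists2 Q : 'M[C]_(k + l), Q ^t* *m Q = 1%:M &
    forall v, crb_ratio X W Z v =
      ((normsq (usubmx (Q *m v)) / normsq (Q *m v))^-1)%:C.
Proof.
move=> WWX mkq ZZ XZ.
have [B BB SB] := compressed_proj_onb WWX erefl mkq ZZ XZ.
have [B' BB' SB'] : exists2 B' : 'M[C]_(l, k + l),
    B' *m B' ^t* = 1%:M & 1%:M - B ^t* *m B = B' ^t* *m B'.
  apply: proj_onb.
  - by rewrite trmxCB trmxC1 trmxCM trmxCK.
  - rewrite mulmxBl mul1mx mulmxBr mulmx1 mulmxA -(mulmxA _ B) BB mulmx1.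
    by rewrite subrr subr0.
  - by rewrite linearB /= mxtrace1 mxtrace_mulC BB mxtrace1 natrD addrC addKr.
(* Orthonormal bases of the range of the projector and of its complement, stacked into a unitary
   matrix: the quadratic form becomes the squared norm of the first [k] coordinates. *)
exists (col_mx B B').
  rewrite tr_col_mx map_row_mx mul_row_col -SB'.
  by rewrite addrC subrK.
move=> v; rewrite invf_div /crb_ratio SB !mulmxA.
rewrite -trmxCM -mulmxA normsq_gram mxE eqxx mulr1n.
rewrite normsq_unitary; last first.
  by rewrite tr_col_mx map_row_mx mul_row_col -SB' addrC subrK.
by rewrite mul_col_mx col_mxKu rmorphM fmorphV.
Qed.

Lemma cramer_rao_scale p (a : C) (J : 'M[C]_p) (i : 'I_p) :
  a != 0 -> J \in unitmx -> cramer_rao (a *: J) i = a^-1 * invmx J i i.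
Proof.
move=> a0 Ju; have au : a \is a GRing.unit by rewrite unitfE.
by rewrite /cramer_rao invmxZ ?mxE// unitmxZ.
Qed.

(** With [v = W^H g] the two bounds are [sigma2 / |v|^2] and [sigma2 / <v, Q v>], so [sigma2]
    cancels. The vector [v] is nonzero because [|v|^2] is the Schur complement of an invertible Gram
    matrix. *)
Lemma cramer_rao_ratio n p N m (sigma2 : R) (G : 'M[C]_(n, p)) (i : 'I_p)
    (X := col' i G) (W : 'M[C]_(n, N)) (Z : 'M[C]_(m, n)) :
  sigma2 != 0 -> resid 1%:M X = W *m W ^t* ->
  G ^t* *m G \in unitmx -> X ^t* *m X \in unitmx ->
  X ^t* *m proj_adj Z *m X \in unitmx ->
  G ^t* *m proj_adj Z *m G \in unitmx ->
  cramer_rao (fisher_compressed sigma2 Z G) i / cramer_rao (fisher sigma2 G) i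
  = crb_ratio X W Z (W ^t* *m col i G) /\ W ^t* *m col i G != 0.
Proof.
move=> s0 WWX GG XX XZ GZ.
have s0' : (sigma2^-1)%:C != 0 by rewrite (inj_eq (@complexI R)) invr_eq0.
have := @invmx_gram_diag _ _ _ 1%:M G i (trmxC1 _ _).
rewrite !mulmx1 => /(_ GG XX).
rewrite -/X; set g := col i G; rewrite WWX => -[a0 E1].
have [_ E2] := invmx_gram_diag (proj_adj_trmxC Z) GZ XZ.
have gWW : g ^t* *m (W *m W ^t*) *m g =
    ((normsq (W ^t* *m g))%:C)%:M.
  by rewrite -normsq_gram trmxCM trmxCK !mulmxA.
rewrite gWW mxE eqxx mulr1n in a0 E1.
split; last by rewrite -normsq_eq0; apply: contra_neq a0 => ->.
have -> := cramer_rao_scale i s0' GZ.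
have -> := cramer_rao_scale i s0' GG.
have t0 : (sigma2^-1)%:C^-1 != 0 :> C by rewrite invr_eq0.
rewrite -mulf_div (divff t0) mul1r E1 E2 invrK mulrC /crb_ratio -/g -/X.
pose S := resid (proj_adj Z) X.
have St : S ^t* = S := resid_trmxC X (proj_adj_trmxC Z).
have SW : S *m (W *m W ^t*) = S by rewrite -WWX; exact: (resid_sub XZ).
have WS : W *m W ^t* *m S = S.
  by rewrite -[in LHS]St -[in RHS]St -[in RHS]SW !trmxCM trmxCK.
suff -> : (W ^t* *m g) ^t* *m compressed_proj X W Z *m (W ^t* *m g) =
    g ^t* *m S *m g by [].
rewrite trmxCM trmxCK /compressed_proj -/S -[in RHS]SW -[in RHS]WS.
by rewrite !mulmxA.
Qed.

End compression.

(** * Lebesgue measure on complex matrices *)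

Section pushes_to.
Context (R : realType).

(** Equality with the image measure is asked on measurable sets only, between bare set functions, so
    that it composes without constructing a new measure. *)
Definition pushes_to d1 d2 (T1 : measurableType d1) (T2 : measurableType d2)
    (mu : set T1 -> \bar R) (nu : set T2 -> \bar R) (f : T1 -> T2) : Prop :=
  measurable_fun [set: T1] f /\
  forall A, measurable A -> mu (f @^-1` A) = nu A.

Lemma pushes_to_prod d1 d2 d3 d4 (T1 : measurableType d1)
    (T2 : measurableType d2) (S1 : measurableType d3) (S2 : measurableType d4)
    (mu1 : {sigma_finite_measure set T1 -> \bar R})
    (mu2 : {sigma_finite_measure set T2 -> \bar R})
    (nu1 : {sigma_finite_measure set S1 -> \bar R})
    (nu2 : {sigma_finite_measure set S2 -> \bar R}) f1 f2 :
  pushes_to mu1 nu1 f1 -> pushes_to mu2 nu2 f2 ->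
  pushes_to (mu1 \x mu2)%E (nu1 \x nu2)%E (fun x => (f1 x.1, f2 x.2)).
Proof.
move=> [mf1 f1E] [mf2 f2E].
have mf : measurable_fun [set: T1 * T2] (fun x => (f1 x.1, f2 x.2)).
  by apply/measurable_fun_pair; apply: measurableT_comp.
split=> // A mA; apply/esym.
apply: (@product_measure_unique _ _ _ _ _ nu1 nu2
  (pushforward (mu1 \x mu2)%E (fun x => (f1 x.1, f2 x.2)))) => // X Y mX mY.
rewrite /pushforward /= -f1E// -f2E// -product_measure1E//.
- by rewrite -[X in measurable X]setTI; exact: mf1.
- by rewrite -[X in measurable X]setTI; exact: mf2.
Qed.

Lemma pushes_to_power d (T : measurableType d)
    (mu nu : {sigma_finite_measure set T -> \bar R}) n (f : 'I_n -> T -> T) :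
  (forall i, pushes_to mu nu (f i)) ->
  pushes_to (power_measure mu n) (power_measure nu n)
    (fun t => [tuple f i (tnth t i) | i < n]).
Proof.
elim: n f => [|n IH] f fE.
  rewrite (_ : (fun _ => _) = id); first by split=> // A mA;
    rewrite preimage_id.
  by apply/funext => t; rewrite [LHS]tuple0 [RHS]tuple0.
have [mf fP] := pushes_to_prod (fE ord0) (IH _ (fun i => fE (lift ord0 i))).
split.
  apply/measurable_fun_tnthP => i;
    rewrite (_ : _ \o _ = f i \o (@tnth _ _)^~ i).
    by apply: measurableT_comp; [case: (fE i)|exact: measurable_tnth].
  by apply/funext => t /=; rewrite tnth_mktuple.
move=> A mA; rewrite /= /cons_measure /pushforward -fP.
  congr (_ _); apply/funext => -[x t] /=; rewrite /preimage /=; congr A.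
  apply/eq_from_tnth => i; rewrite tnth_mktuple.
  have [j ->|->] := unliftP ord0 i; last by [].
  by rewrite !tnthS tnth_mktuple.
by rewrite -[X in measurable X]setTI; exact: measurable_cons_pair.
Qed.

Lemma power_measure_cube d (T : measurableType d)
    (mu : {sigma_finite_measure set T -> \bar R}) n (A : set T) : measurable A
      ->
  power_measure mu n [set t | forall i, A (tnth t i)] = (mu A ^+ n)%E.
Proof.
move=> mA; elim: n => [|n IH].
  by rewrite /= /dirac /= indicE mem_set// => -[].
rewrite expeS -IH [LHS]/= /cons_measure /pushforward -product_measure1E//;
  last first.
  rewrite (_ : [set t | _] = \bigcap_(i in [set: 'I_n])
    ((@tnth n T)^~ i @^-1` A)).
    apply: fin_bigcap_measurable => // i _.
    by rewrite -[X in measurable X]setTI; apply: measurable_tnth.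
  by apply/seteqP; split=> t tA i; [move=> _|]; apply: tA.
congr (_ _); apply/seteqP; split=> -[x t] /=.
  move=> xtA; split; first exact: (xtA ord0).
  by move=> i; have := xtA (lift ord0 i); rewrite tnthS.
move=> [/= xA tA] i; have [j ->|->] := unliftP ord0 i; last by [].
by rewrite tnthS; exact: tA.
Qed.

Local Notation leb := (@lebesgue_measure R).

Lemma lebesgue_translation (c : R) : pushes_to leb leb (fun x => x + c).
Proof.
have mf : measurable_fun [set: R] (fun x : R => x + c).
  exact: measurable_funD.
split=> // A mA; apply/esym.
pose f : measurableTypeR R -> measurableTypeR R := fun x => x + c.
rewrite (@lebesgue_measure_unique R (pushforward leb f))// => X [[a b] _ <-].
rewrite -[RHS]/(leb (f @^-1` `]a, b])) (_ : f @^-1` _ = `]a - c,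
  b - c]%classic).
  rewrite !lebesgue_measure_itv /= !lte_fin ltrD2r; case: ifP => // _.
  by rewrite -!EFinB; congr _%:E; ring.
by apply/seteqP; split=> x; rewrite /= !in_itv /= ltrBlDr lerBrDr.
Qed.

Lemma lebesgue_scaling (s : {posnum R}) :
  pushes_to leb (mscale (s%:num^-1)%:nng leb) ( *%R s%:num).
Proof.
have mf : measurable_fun [set: R] ( *%R s%:num).
  exact: measurable_funM.
split=> // A mA; rewrite /mscale /=.
pose f : measurableTypeR R -> measurableTypeR R := *%R s%:num.
rewrite (@lebesgue_measure_unique R (mscale s%:num%:nng (pushforward leb f)) _
  A)//.
  rewrite -[X in _ = (_ * X)%E]/((s%:num)%:E * leb (f @^-1` A))%E.
  by rewrite muleA -EFinM mulVf// mul1e.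
move=> X [[a b] _ <-].
rewrite -[RHS]/((s%:num)%:E * leb (f @^-1` `]a, b]))%E (_ : f @^-1` _ = `]a /
  s%:num, b / s%:num]%classic).
  rewrite !lebesgue_measure_itv /= !lte_fin ltr_pM2r//; case: ifP => // _.
    by rewrite -!EFinB -EFinM mulrBr !(mulrC s%:num) !divfK.
  by rewrite mule0.
by apply/seteqP; split=> x; rewrite /= !in_itv /= ltr_pdivrMr// ler_pdivlMr//
  (mulrC x).
Qed.

Local Notation cleb := (@complex_lebesgue_measure R).

Lemma measurable_fun_Complex d (T : measurableType d) (f g : T -> R) :
  measurable_fun [set: T] f -> measurable_fun [set: T] g ->
  measurable_fun [set: T] (fun x => f x +i* g x).
Proof. by move=> mf mg; apply/measurable_fun_complexP; split. Qed.

Lemma complex_lebesgue_translation (c : R[i]) :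
  pushes_to cleb cleb (fun z => z + c).
Proof.
case: c => a b; have [mf fE] :=
  pushes_to_prod (lebesgue_translation a) (lebesgue_translation b).
split.
  rewrite (_ : (fun z : R[i] => _) = fun z =>
    (complex.Re z + a) +i* (complex.Im z + b)).
    apply: measurable_fun_Complex; apply: measurable_funD => //.
      exact: measurable_Re.
    exact: measurable_Im.
  by apply/funext => -[x y].
move=> A mA; rewrite /complex_lebesgue_measure /pushforward -[RHS]fE;
  last first.
  by rewrite -[X in measurable X]setTI; exact: measurable_complex_of_pair.
by congr (_ _); apply/funext => -[x y].
Qed.

Definition csquare (r : R) : set R[i] :=
  [set z | (0 <= complex.Re z <= r) && (0 <= complex.Im z <= r)].

Lemma csquareE r : csquare r = @complex.Re R @^-1` `[0, r] `&` @complex.Im R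
  @^-1` `[0, r].
Proof.
by apply/seteqP; split=> z; rewrite /csquare /= !in_itv /=;
  [move=> /andP[-> ->]|move=> [-> ->]].
Qed.

Lemma measurable_csquare r : measurable (csquare r).
Proof.
rewrite csquareE; apply: measurableI; rewrite -[X in measurable X]setTI.
  exact: measurable_Re.
exact: measurable_Im.
Qed.

Lemma complex_lebesgue_csquare (r : R) : 0 <= r ->
  cleb (csquare r) = (r ^+ 2)%:E.
Proof.
move=> r0; rewrite /complex_lebesgue_measure /pushforward.
rewrite (_ : _ @^-1` _ = `[0, r]%classic `*` `[0, r]%classic); last first.
  by rewrite csquareE; apply/seteqP; split=> -[].
have E : leb `[0, r]%classic = r%:E.
  rewrite lebesgue_measure_itv /= lte_fin; case: ltrP => r0'.
    by rewrite EFinN sube0.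
  by rewrite (_ : r = 0)//; apply/eqP; rewrite eq_le r0 r0'.
by rewrite product_measure1E// expr2 EFinM -[in RHS]E.
Qed.

Local Notation mleb := (@mx_lebesgue_measure R _ _).

Lemma mx_lebesgue_translation m n (D : 'M[R[i]]_(m, n)) :
  pushes_to mleb mleb (fun Z => Z + D).
Proof.
have [mf fE] := @pushes_to_power _ _ _ _ m _ (fun i =>
  @pushes_to_power _ _ _ _ n _ (fun j => complex_lebesgue_translation (D i j))).
split.
  apply/measurable_fun_mxP => i j; under eq_fun do rewrite mxE.
  apply: (@measurableT_comp _ _ _ _ _ _ (fun z : R[i] => z + D i j)).
    by case: (complex_lebesgue_translation (D i j)).
  exact: measurable_mx_entry.
move=> A mA; rewrite /mx_lebesgue_measure /pushforward -[RHS]fE.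
  congr (_ _); apply/funext => t; rewrite /preimage /=; congr A.
  by apply/matrixP => i j; rewrite !mxE !tnth_mktuple.
by rewrite -[X in measurable X]setTI; exact: measurable_mx_of_rows.
Qed.

Definition mxcube m n (r : R) : set 'M[R[i]]_(m, n) :=
  [set Z | forall i j, csquare r (Z i j)].

Lemma measurable_mxcube m n r : measurable (@mxcube m n r).
Proof.
rewrite (_ : mxcube r = \bigcap_(i in [set: 'I_m]) \bigcap_(j in [set: 'I_n])
    ((fun Z : 'M[R[i]]_(m, n) => Z i j) @^-1` csquare r)).
  apply: fin_bigcap_measurable => // i _; apply: fin_bigcap_measurable =>
    // j _.
  by rewrite -[X in measurable X]setTI; apply: measurable_mx_entry => //;
    exact: measurable_csquare.
by apply/seteqP; split=> [Z ZA i _ j _|Z ZA i j]; apply: ZA.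
Qed.

Lemma mx_lebesgue_mxcube m n (r : R) : 0 <= r ->
  mx_lebesgue_measure (@mxcube m n r) = (r ^+ (2 * n * m))%:E.
Proof.
move=> r0; rewrite /mx_lebesgue_measure /pushforward.
pose A := [set t : n.-tuple R[i] | forall j, csquare r (tnth t j)].
have mA : measurable A.
  rewrite (_ : A = \bigcap_(j in [set: 'I_n])
    ((@tnth n R[i])^~ j @^-1` csquare r)).
    apply: fin_bigcap_measurable => // j _; rewrite -[X in measurable X]setTI.
    by apply: measurable_tnth => //; exact: measurable_csquare.
  by apply/seteqP; split=> [t tA j _|t tA j]; apply: tA.
rewrite (_ : _ @^-1` _ = [set t | forall i, A (tnth t i)]); last first.
  by apply/seteqP; split=> t tA i j; have := tA i j; rewrite mxE.
rewrite power_measure_cube// power_measure_cube; last exact: measurable_csquare.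
transitivity (((r ^+ 2)%:E ^+ n) ^+ m)%E; last first.
  by rewrite -!EFin_expe -!exprM mulnA.
by rewrite -complex_lebesgue_csquare.
Qed.

End pushes_to.

(** * Measurability of complex and matrix operations *)

Section complex_measurability.
Context (R : realType) d (T : measurableType d).
Implicit Types f g : T -> R[i].

Lemma measurable_cD f g : measurable_fun [set: T] f ->
  measurable_fun [set: T] g ->
  measurable_fun [set: T] (fun x => f x + g x).
Proof.
move=> /measurable_fun_complexP[fr fi] /measurable_fun_complexP[gr gi].
apply/measurable_fun_complexP; split.
  rewrite (_ : _ \o _ = fun x => complex.Re (f x) + complex.Re (g x)).
    exact: measurable_funD.
  by apply/funext => x /=; case: (f x) (g x) => [? ?] [? ?].
rewrite (_ : _ \o _ = fun x => complex.Im (f x) + complex.Im (g x)).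
  exact: measurable_funD.
by apply/funext => x /=; case: (f x) (g x) => [? ?] [? ?].
Qed.

Lemma measurable_cM f g : measurable_fun [set: T] f ->
  measurable_fun [set: T] g ->
  measurable_fun [set: T] (fun x => f x * g x).
Proof.
move=> /measurable_fun_complexP[fr fi] /measurable_fun_complexP[gr gi].
rewrite (_ : (fun x => _) = fun x =>
  (complex.Re (f x) * complex.Re (g x) - complex.Im (f x) * complex.Im (g x))
    +i*
  (complex.Re (f x) * complex.Im (g x) + complex.Im (f x) * complex.Re (g x))).
  apply: measurable_fun_Complex.
    by apply: measurable_funB;
      apply: measurable_funM.
  by apply: measurable_funD;
    apply: measurable_funM.
by apply/funext => x /=; case: (f x) (g x) => [? ?] [? ?].
Qed.

Lemma measurable_conj f : measurable_fun [set: T] f ->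
  measurable_fun [set: T] (fun x => Num.conj (f x)).
Proof.
move=> /measurable_fun_complexP[fr fi].
rewrite (_ : (fun x => _) = fun x =>
   complex.Re (f x) +i* (- complex.Im (f x))).
  by apply: measurable_fun_Complex => //; exact: measurable_funN.
by apply/funext => x /=; rewrite -[LHS]/((f x)^*)%C; case: (f x).
Qed.

Lemma measurable_real_complex (f : T -> R) : measurable_fun [set: T] f ->
  measurable_fun [set: T] (fun x => (f x)%:C).
Proof. by move=> mf; apply: measurable_fun_Complex => //;
  exact: measurable_cst. Qed.

(** [1 / y = y * (y^2)^(-1)] brings inversion back to a real power of a nonnegative number; at
    [y = 0] both sides are 0. *)
Lemma measurable_invr (f : T -> R) : measurable_fun [set: T] f ->
  measurable_fun [set: T] (fun x => (f x)^-1).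
Proof.
move=> mf; rewrite (_ : (fun x => _) = fun x => f x * (f x ^+ 2) `^ (-1)).
  apply: measurable_funM => //.
  apply: (@measurableT_comp _ _ _ _ _ _ (fun y : R => y `^ (-1))).
    exact: measurable_powR.
  exact: measurable_funX.
apply/funext => x; rewrite powR_inv1 ?sqr_ge0// expr2.
have [->|f0] := eqVneq (f x) 0; first by rewrite invr0 mul0r.
by rewrite invfM mulrA divff// mul1r.
Qed.

Lemma measurable_cV f : measurable_fun [set: T] f ->
  measurable_fun [set: T] (fun x => (f x)^-1).
Proof.
move=> mf; have /measurable_fun_complexP[fr fi] := mf.
rewrite (_ : (fun x => _) = fun x => Num.conj (f x) *
  ((complex.Re (f x) ^+ 2 + complex.Im (f x) ^+ 2)^-1)%:C).
  apply: measurable_cM; first exact: measurable_conj.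
  apply/measurable_real_complex/measurable_invr.
  by apply: measurable_funD; exact: measurable_funX.
apply/funext => x /=.
rewrite [X in _ * X](_ : _ = (Num.conj (f x) * f x)^-1); last first.
  by rewrite mul_conj_normsq fmorphV.
have [->|f0] := eqVneq (f x) 0; first by rewrite invr0 rmorph0 mul0r.
by rewrite invfM mulrA divff ?mul1r// conjC_eq0.
Qed.

Lemma measurable_csum (I : Type) (s : seq I) (F : I -> T -> R[i]) :
  (forall i, measurable_fun [set: T] (F i)) ->
  measurable_fun [set: T] (fun x => \sum_(i <- s) F i x).
Proof.
move=> mF; elim: s => [|i s IH].
  by under eq_fun do rewrite big_nil; exact: measurable_cst.
by under eq_fun do rewrite big_cons; exact: measurable_cD.
Qed.

Lemma measurable_cprod (I : Type) (s : seq I) (F : I -> T -> R[i]) :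
  (forall i, measurable_fun [set: T] (F i)) ->
  measurable_fun [set: T] (fun x => \prod_(i <- s) F i x).
Proof.
move=> mF; elim: s => [|i s IH].
  by under eq_fun do rewrite big_nil; exact: measurable_cst.
by under eq_fun do rewrite big_cons; exact: measurable_cM.
Qed.

End complex_measurability.

Section matrix_measurability.
Context (R : realType) d (T : measurableType d).

Lemma measurable_mxD m n (f g : T -> 'M[R[i]]_(m, n)) :
  measurable_fun [set: T] f -> measurable_fun [set: T] g ->
  measurable_fun [set: T] (fun x => f x + g x).
Proof.
move=> /measurable_fun_mxP mf /measurable_fun_mxP mg;
  apply/measurable_fun_mxP => i j.
by under eq_fun do rewrite mxE; exact: measurable_cD.
Qed.

Lemma measurable_scalemx m n (a : T -> R[i]) (f : T -> 'M[R[i]]_(m, n)) :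
  measurable_fun [set: T] a -> measurable_fun [set: T] f ->
  measurable_fun [set: T] (fun x => a x *: f x).
Proof.
move=> ma /measurable_fun_mxP mf; apply/measurable_fun_mxP => i j.
by under eq_fun do rewrite mxE; exact: measurable_cM.
Qed.

Lemma measurable_mxN m n (f : T -> 'M[R[i]]_(m, n)) :
  measurable_fun [set: T] f -> measurable_fun [set: T] (fun x => - f x).
Proof.
move=> mf; under eq_fun do rewrite -scaleN1r.
by apply: measurable_scalemx => //; exact: measurable_cst.
Qed.

Lemma measurable_mulmx m n p (f : T -> 'M[R[i]]_(m, n))
  (g : T -> 'M[R[i]]_(n, p)) :
  measurable_fun [set: T] f -> measurable_fun [set: T] g ->
  measurable_fun [set: T] (fun x => f x *m g x).
Proof.
move=> /measurable_fun_mxP mf /measurable_fun_mxP mg;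
  apply/measurable_fun_mxP => i j.
under eq_fun do rewrite mxE.
by apply: measurable_csum => k; exact: measurable_cM.
Qed.

Lemma measurable_trmxC m n (f : T -> 'M[R[i]]_(m, n)) :
  measurable_fun [set: T] f -> measurable_fun [set: T] (fun x => (f x) ^t*).
Proof.
move=> /measurable_fun_mxP mf; apply/measurable_fun_mxP => i j.
by under eq_fun do rewrite !mxE; exact: measurable_conj.
Qed.

Lemma measurable_det n (f : T -> 'M[R[i]]_n) :
  measurable_fun [set: T] f -> measurable_fun [set: T] (fun x => \det (f x)).
Proof.
move=> /measurable_fun_mxP mf; apply: measurable_csum => s.
by apply: measurable_cM; [exact: measurable_cst|exact: measurable_cprod].
Qed.

Lemma measurable_adjugate n (f : T -> 'M[R[i]]_n) :
  measurable_fun [set: T] f -> measurable_fun [set: T] (fun x => \adj (f x)).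
Proof.
move=> /measurable_fun_mxP mf; apply/measurable_fun_mxP => i j.
under eq_fun do rewrite mxE; apply: measurable_cM; first exact: measurable_cst.
apply: measurable_det; apply/measurable_fun_mxP => k l.
by under eq_fun do rewrite !mxE; exact: mf.
Qed.

Lemma measurable_det_eq0 n (f : T -> 'M[R[i]]_n) :
  measurable_fun [set: T] f -> measurable [set x | \det (f x) = 0].
Proof.
move=> /measurable_det /measurable_fun_complexP[mr mi].
rewrite (_ : [set x | _] = (fun x => complex.Re (\det (f x))) @^-1` [set 0] `&`
   (fun x => complex.Im (\det (f x))) @^-1` [set 0]).
  by apply: measurableI; rewrite -[X in measurable X]setTI;
    [exact: mr|exact: mi].
apply/seteqP; split=> x /=; first by move=> ->.
by case: (\det _) => a b /= [-> ->].
Qed.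

Lemma measurable_invmx n (f : T -> 'M[R[i]]_n) :
  measurable_fun [set: T] f -> measurable_fun [set: T] (fun x => invmx (f x)).
Proof.
move=> mf; rewrite /invmx; under eq_fun do rewrite unitmxE unitfE.
(* On singular matrices [invmx] returns its argument, so the second branch is [f] itself; the first
   is the adjugate formula. *)
apply: measurable_fun_ifT => //.
- apply: (measurable_fun_bool false); rewrite setTI.
  rewrite (_ : _ @^-1` _ = [set x | \det (f x) = 0]);
    first exact: measurable_det_eq0.
  by apply/seteqP; split=> x /= => [/negbFE/eqP|->]; rewrite ?eqxx.
- apply: measurable_scalemx; last exact: measurable_adjugate.
  exact/measurable_cV/measurable_det.
Qed.

Lemma measurable_normsq m n (f : T -> 'M[R[i]]_(m, n)) :
  measurable_fun [set: T] f -> measurable_fun [set: T] (fun x => normsq (f x)).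
Proof.
move=> /measurable_fun_mxP mf; apply: measurable_sum => i;
  apply: measurable_sum => j.
have /measurable_fun_complexP[mr mi] := mf i j.
by apply: measurable_funD; exact: measurable_funX.
Qed.

End matrix_measurability.

(** * Uniqueness of translation-invariant measures *)

Section translation_invariant_measures.
Context (R : realType) (m n : nat).
Local Notation T := 'M[R[i]]_(m, n).
Local Notation mleb := (@mx_lebesgue_measure R m n).

Lemma product_measure_swap d1 d2 (T1 : measurableType d1)
    (T2 : measurableType d2) (m1 : {sigma_finite_measure set T1 -> \bar R})
    (m2 : {sigma_finite_measure set T2 -> \bar R}) A : measurable A ->
  (m1 \x m2)%E A = (m1 \x^ m2)%E A.
Proof.
by move=> mA; apply: product_measure_unique => // X Y mX mY;
  exact: product_measure2E.
Qed.

(* Tonelli on [{(x, y) | A x /\ B (x + y)}], after the shift [x -> x - y]. *)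
Lemma tinv_exchange (mu nu : {sigma_finite_measure set T -> \bar R})
  (A B : set T) :
  (forall D, pushes_to mu mu (fun Z => Z + D)) ->
  (forall D, pushes_to nu nu (fun Z => Z + D)) ->
  measurable A -> measurable B ->
  (nu A * mu B = nu B * mu (-%R @^-1` A))%E.
Proof.
move=> tmu tnu mA mB.
have pm d1 d2 (U : measurableType d1) (V : measurableType d2) (f : U -> V) C :
    measurable_fun [set: U] f -> measurable C -> measurable (f @^-1` C).
  by move=> mf mC; rewrite -[X in measurable X]setTI; exact: mf.
have m1 : measurable_fun [set: T * T] (@fst T T) by exact: measurable_fst.
have m2 : measurable_fun [set: T * T] (@snd T T) by exact: measurable_snd.
have mN : measurable_fun [set: T] (-%R : T -> T) by exact: measurable_mxN.
pose S : set (T * T) := fst @^-1` A `&` (fun z => z.2 + z.1) @^-1` B.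
pose S' : set (T * T) := (fun z => z.1 - z.2) @^-1` A `&` fst @^-1` B.
have mS : measurable S.
  by apply: measurableI; apply: pm => //; exact: measurable_mxD.
have mS' : measurable S'.
  by apply: measurableI; apply: pm => //; apply: measurable_mxD => //;
    exact: measurable_mxN.
have half (X : set T) (Q : set (T * T)) (c : \bar R) : measurable X ->
  (0 <= c)%E ->
    (forall x, X x -> mu (xsection Q x) = c) ->
    (forall x, ~ X x -> mu (xsection Q x) = 0%E) ->
      (nu \x mu)%E Q = (nu X * c)%E.
  move=> mX c0 cX cNX; rewrite /product_measure1.
  rewrite (eq_integral (fun x => (\1_X x)%:E * c)%E) => [|x _].
    rewrite ge0_integralZr ?integral_indic ?setIT//.
    exact/measurable_EFinP/measurable_indic.
  rewrite indicE /=; case: (asboolP (X x)) => Xx.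
    by rewrite mem_set// mul1e cX.
  by rewrite memNset// mul0e cNX.
have <- : (nu \x mu)%E S = (nu A * mu B)%E.
  apply: half => // x xA.
    have [_ E] := tmu x; rewrite -[RHS]E//; congr (_ _); apply/seteqP.
    by split=> y; rewrite /xsection /S /= inE => //= -[].
  rewrite (_ : xsection _ _ = set0) ?measure0// -subset0 => y.
  by rewrite /xsection /S /= inE => -[].
have <- : (nu \x mu)%E S' = (nu B * mu (-%R @^-1` A))%E.
  apply: half => // x xB.
    have [_ E] := tmu (- x); rewrite -[RHS]E; last exact: pm.
    congr (_ _); apply/seteqP; split=> y;
      rewrite /xsection /S' /= inE /= opprD opprK addrC.
      by case.
    by [].
  rewrite (_ : xsection _ _ = set0) ?measure0// -subset0 => y.
  by rewrite /xsection /S' /= inE => -[].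
rewrite !product_measure_swap// /product_measure2; apply: eq_integral => y _ /=.
have [_ E] := tnu y; rewrite -[RHS]E; last exact: measurable_ysection.
congr (_ _); apply/seteqP; split=> x; rewrite /ysection /S /S' /= !inE /=.
  by rewrite addrC addrK.
by rewrite addrK addrC.
Qed.

(** The exchange identity for Lebesgue measure against itself, with [B] the unit cube. This symmetry
    removes the reflection when another measure is compared with Lebesgue measure. *)
Lemma mx_lebesgue_opp (A : set T) : measurable A -> mleb (-%R @^-1` A) = mleb A.
Proof.
move=> mA.
have /= := @tinv_exchange mleb mleb A (mxcube 1)
  (@mx_lebesgue_translation _ _ _)
   (@mx_lebesgue_translation _ _ _) mA (@measurable_mxcube R m n 1).
by rewrite mx_lebesgue_mxcube// expr1n mule1 mul1e.
Qed.

Lemma tinv_unique (nu : {sigma_finite_measure set T -> \bar R}) :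
  (forall D, pushes_to nu nu (fun Z => Z + D)) ->
  forall A, measurable A -> (nu A = nu (mxcube 1) * mleb A)%E.
Proof.
move=> tnu A mA.
have /= := @tinv_exchange mleb nu A (mxcube 1) (@mx_lebesgue_translation _ _ _)
   tnu mA (@measurable_mxcube R m n 1).
by rewrite mx_lebesgue_mxcube// expr1n mule1 => ->; rewrite mx_lebesgue_opp.
Qed.

(** Uniqueness applied to the image of [mu] under [f]; the measurable left inverse [g] is what
    carries sigma-finiteness over to the image. *)
Lemma tinv_image_unique d (S : measurableType d)
    (mu : {sigma_finite_measure set S -> \bar R}) (f : S -> T) (g : T -> S) :
  measurable_fun [set: S] f -> measurable_fun [set: T] g -> cancel f g ->
  (forall (D : T) (A : set T), measurable A ->
     mu (f @^-1` ((fun Z => Z + D) @^-1` A)) = mu (f @^-1` A)) ->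
  forall A, measurable A ->
    (mu (f @^-1` A) = mu (f @^-1` mxcube 1) * mleb A)%E.
Proof.
move=> mf mg fK tmu A mA.
have sf := sigma_finite_pushforward (sigma_finiteT mu) mg fK.
pose nu0 : {measure set T -> \bar R} :=
  measure_function_pushforward__canonical__measure_function_Measure mu mf.
pose H := Measure_isSigmaFinite.Build _ _ _ nu0 sf.
pose nu : {sigma_finite_measure set T -> \bar R} :=
  HB.pack (pushforward mu f) (Measure.class nu0) H.
have tnu D : pushes_to (nu mf) (nu mf) (fun Z => Z + D).
  by split; [exact: measurable_mxD|move=> B mB; exact: tmu].
exact: (@tinv_unique (nu mf) tnu A mA).
Qed.

(** The parameter bounds the squared norm, so the volume grows as [r ^+ (n * m)], half the real
    dimension. *)
Definition mxball (r : R) : set T := [set Z | normsq Z <= r].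

Lemma measurable_normsq_le d (S : measurableType d) (f : S -> T) (r : R) :
  measurable_fun [set: S] f -> measurable [set x | normsq (f x) <= r].
Proof.
move=> /measurable_normsq mf; rewrite
  (_ : [set x | _] = (fun x => normsq (f x)) @^-1` `]-oo, r]).
  by rewrite -[X in measurable X]setTI; exact: mf.
by apply/seteqP; split=> x /=; rewrite in_itv.
Qed.

Lemma measurable_mxball r : measurable (mxball r).
Proof. by apply: measurable_normsq_le; exact: measurable_id. Qed.

Lemma mxball_gt0 : (0 < mleb (mxball 1))%E.
Proof.
(* A cube of side [r] has squared norms at most [2 m n r^2 <= 1]; the successor keeps [r] positive
   when [m n = 0]. *)
pose r : R := (2 * m * n).+1%:R^-1.
have r0 : 0 < r by rewrite invr_gt0.
apply: (@lt_le_trans _ _ (mleb (mxcube r))).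
  by rewrite mx_lebesgue_mxcube ?ltW// lte_fin exprn_gt0.
apply: le_measure; rewrite ?inE;
  [exact: measurable_mxcube|exact: measurable_mxball|].
move=> Z Zr; rewrite /mxball /=.
apply: (@le_trans _ _ (\sum_(i < m) \sum_(j < n) (r ^+ 2 + r ^+ 2))).
  apply: ler_sum => i _; apply: ler_sum => j _.
  have /andP[/andP[a0 ar] /andP[b0 br]] := Zr i j.
  by apply: lerD; rewrite ler_sqr ?nnegrE// ltW.
rewrite !sumr_const !card_ord -mulr2n -!mulrnA expr2 -mulrnAr.
rewrite -[leRHS]mulr1; apply: ler_pM.
- exact: ltW.
- by rewrite mulrn_wge0// ltW.
- by rewrite invf_le1// ler1n.
- by rewrite -mulr_natr mulrC ler_pdivrMr// mul1r ler_nat; lia.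
Qed.

Lemma mxball_lty : (mleb (mxball 1) < +oo)%E.
Proof.
(* The cube has its corner at 0, so the ball is recentred at the matrix with all entries [1 + i],
   where it fits in the cube of side 2. *)
pose D : T := const_mx (-1 -i* 1).
have [_ <-] := mx_lebesgue_translation D; last exact: measurable_mxball.
apply: (@le_lt_trans _ _ (mleb (mxcube 2))); last first.
  by rewrite mx_lebesgue_mxcube// ltry.
apply: le_measure; rewrite ?inE; last 2 first.
- exact: measurable_mxcube.
- move=> Z /= ZD i j; have : (complex.Re (Z i j) - 1) ^+ 2 +
  (complex.Im (Z i j) - 1) ^+ 2 <= 1.
    apply: le_trans ZD; apply: le_trans (normsq_entry_le _ i j).
    by rewrite !mxE; case: (Z i j).
  rewrite /csquare /=; move: (complex.Re _) (complex.Im _) => a b ab.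
  have h (x : R) : x ^+ 2 <= 1 -> -1 <= x <= 1.
    by rewrite -ler_norml -real_normK ?num_real// expr_le1.
  have /h/andP[a0 a1] : (a - 1) ^+ 2 <= 1 by rewrite (le_trans _ ab)// lerDl
    sqr_ge0.
  have /h/andP[b0 b1] : (b - 1) ^+ 2 <= 1 by rewrite (le_trans _ ab)// lerDr
    sqr_ge0.
  by apply/andP; split; apply/andP; split; lra.
- rewrite -[X in measurable X]setTI; apply: measurable_mxD => //.
  exact: measurable_mxball.
Qed.

End translation_invariant_measures.

(** * Lebesgue measure under isometries, dilations and stacking *)

Section linear_images.
Context (R : realType).
Local Notation mleb := (@mx_lebesgue_measure R _ _).

(** The image measure is translation invariant, hence [c] times Lebesgue measure. As [f] preserves
    the unit ball, of finite positive volume, [c = 1]. *)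
Lemma mx_lebesgue_isometry m n (f g : 'M[R[i]]_(m, n) -> 'M[R[i]]_(m, n)) :
  measurable_fun [set: 'M[R[i]]_(m, n)] f ->
  measurable_fun [set: 'M[R[i]]_(m, n)] g ->
  cancel f g -> cancel g f -> {morph f : Y Z / Y + Z} ->
  (forall Z, normsq (f Z) = normsq Z) -> pushes_to mleb mleb f.
Proof.
move=> mf mg fK gK fD fN; split=> // A mA.
have tf (D : 'M[R[i]]_(m, n)) (B : set 'M[R[i]]_(m, n)) : measurable B ->
    mleb (f @^-1` ((fun Z => Z + D) @^-1` B)) = mleb (f @^-1` B).
  move=> mB; have [_ E] := mx_lebesgue_translation (g D).
  rewrite -[RHS]E; last by rewrite -[X in measurable X]setTI; exact: mf.
  by congr (_ _); apply/funext => Z; rewrite /preimage /= fD gK.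
have fE1 := tinv_image_unique mf mg fK tf.
rewrite fE1//; set c := (X in (X * _)%E = _).
suff -> : c = 1%E by rewrite mul1e.
have e : mleb (@mxball R m n 1) = (c * mleb (@mxball R m n 1))%E.
  rewrite -[RHS]fE1; last exact: measurable_mxball.
  by congr (_ _); apply/funext => Z; rewrite /preimage /mxball /= fN.
move: e (@mxball_gt0 R m n) (@mxball_lty R m n).
case: (mx_lebesgue_measure _) => // x + x0 _; rewrite lte_fin in x0.
case: c => [c||].
- rewrite -EFinM => -[] /(congr1 (fun y => y / x)).
  by rewrite mulfK ?gt_eqF// divff ?gt_eqF// => <-.
- by rewrite mulyr gtr0_sg// mul1e.
- by rewrite mulNyr gtr0_sg// mul1e.
Qed.

Lemma mx_lebesgue_mulr_unitary m n (U : 'M[R[i]]_n) : U *m U ^t* = 1%:M ->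
  pushes_to mleb mleb (fun Z : 'M[R[i]]_(m, n) => Z *m U).
Proof.
move=> UU; have UU' := mulmx1C UU.
apply: (@mx_lebesgue_isometry _ _ _ (fun Z => Z *m U ^t*)).
- by apply: measurable_mulmx => //; exact: measurable_cst.
- by apply: measurable_mulmx => //; exact: measurable_cst.
- by move=> Z; rewrite -mulmxA UU mulmx1.
- by move=> Z; rewrite -mulmxA UU' mulmx1.
- by move=> Y Z; rewrite mulmxDl.
- by move=> Z; exact: normsq_mulr_unitary.
Qed.

Lemma mx_lebesgue_mull_unitary n (U : 'M[R[i]]_n) : U ^t* *m U = 1%:M ->
  pushes_to mleb mleb (fun v : 'cV[R[i]]_n => U *m v).
Proof.
move=> UU; have UU' := mulmx1C UU.
apply: (@mx_lebesgue_isometry _ _ _ (fun Z => U ^t* *m Z)).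
- by apply: measurable_mulmx => //; exact: measurable_cst.
- by apply: measurable_mulmx => //; exact: measurable_cst.
- by move=> Z; rewrite mulmxA UU mul1mx.
- by move=> Z; rewrite mulmxA UU' mul1mx.
- by move=> Y Z; rewrite mulmxDr.
- by move=> Z; exact: normsq_unitary.
Qed.

(** The factor is read off on the unit cube, whose dilate is the cube of side [s]; the exponent is
    the real dimension. *)
Lemma mx_lebesgue_scaling m n (s : R) (A : set 'M[R[i]]_(m, n)) :
  0 < s -> measurable A ->
  mleb [set Z | A ((s^-1)%:C *: Z)] = ((s ^+ (2 * n * m))%:E * mleb A)%E.
Proof.
move=> s0 mA; have sC : s%:C != 0 :> R[i] by rewrite (inj_eq (@complexI R))
  gt_eqF.
have sV : (s^-1)%:C = s%:C^-1 :> R[i] by rewrite fmorphV.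
have mZ (a : R[i]) : measurable_fun [set: 'M[R[i]]_(m, n)]
  (fun Z : 'M[R[i]]_(m, n) => a *: Z).
  by apply: measurable_scalemx => //; exact: measurable_cst.
have fK : cancel (fun Z : 'M[R[i]]_(m, n) => (s^-1)%:C *: Z)
  (fun Z => s%:C *: Z).
  by move=> Z; rewrite scalerA sV mulfV ?scale1r.
rewrite [LHS](@tinv_image_unique R m n _ _ (@mx_lebesgue_measure R m n) _ _
  (mZ (s^-1)%:C) (mZ s%:C) fK)//.
- rewrite -(mx_lebesgue_mxcube m n (ltW s0)); congr (_ * _)%E; congr (_ _).
  apply/seteqP; split=> Z Zc i j; have := Zc i j; rewrite /csquare /= mxE;
    case: (Z i j) => a b /=; rewrite !mul0r !(subr0, addr0, add0r);
    rewrite !(mulrC s^-1) !pmulr_lge0 ?invr_gt0// !ler_pdivrMr// !mul1r//.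
- move=> D B mB; have [_ E] := mx_lebesgue_translation (s%:C *: D).
  rewrite -[RHS]E; last by rewrite -[X in measurable X]setTI; exact: mZ.
  by congr (_ _); apply/funext => Z;
    rewrite /preimage /= scalerDr scalerA sV mulVf ?scale1r.
Qed.

Lemma mx_lebesgue_mxball m n (r : R) : (0 < n * m)%N -> 0 <= r ->
  mleb (@mxball R m n r) = ((r ^+ (n * m))%:E * mleb (@mxball R m n 1))%E.
Proof.
move=> nm0; rewrite le_eqVlt => /predU1P[<-|r0].
  (* At [r = 0] the dilation is not invertible; the ball then lies in the cube of side 0. *)
  rewrite expr0n eqn0Ngt nm0 mul0e.
  apply/eqP; rewrite eq_le measure_ge0 andbT.
  apply: (@le_trans _ _ (mleb (@mxcube R m n 0))).
    apply: le_measure; rewrite ?inE;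
      [exact: measurable_mxball|exact: measurable_mxcube|].
    move=> Z Z0 i j; have : (complex.Re (Z i j)) ^+ 2 + (complex.Im (Z i j)) ^+
      2 <= 0.
      exact: le_trans (normsq_entry_le _ i j) Z0.
    rewrite /csquare /=; move: (complex.Re _) (complex.Im _) => a b ab.
    have [-> ->] : a = 0 /\ b = 0.
      by split; apply/eqP; rewrite -sqrf_eq0 eq_le sqr_ge0 andbT;
        rewrite (le_trans _ ab)// ?lerDl ?lerDr sqr_ge0.
    by rewrite lexx.
  by rewrite mx_lebesgue_mxcube// expr0n -mulnA muln_eq0 /= eqn0Ngt nm0.
have s0 : 0 < Num.sqrt r by rewrite sqrtr_gt0.
rewrite -{2}(sqr_sqrtr (ltW r0)) -exprM mulnA -mx_lebesgue_scaling//;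
  last first.
  exact: measurable_mxball.
congr (_ _); apply/funext => Z;
  rewrite /mxball /= normsqZ exprVn (sqr_sqrtr (ltW r0)).
by rewrite ler_pdivrMl// mulr1.
Qed.

(** Both sides are translation invariant and give mass 1 to the unit cube, which spares a comparison
    of the two constructions from tuples of rows. *)
Lemma mx_lebesgue_col_mx k l (A : set 'cV[R[i]]_(k + l)) : measurable A ->
  mleb A = (@mx_lebesgue_measure R k 1 \x @mx_lebesgue_measure R l 1)%E
    ((fun z => col_mx z.1 z.2) @^-1` A).
Proof.
move=> mA.
have mf : measurable_fun [set: 'cV[R[i]]_k * 'cV[R[i]]_l]
    (fun z => col_mx z.1 z.2).
  apply/measurable_fun_mxP => i j.
  have [i' ->|i' ->] := split_ordP i.
    under eq_fun do rewrite col_mxEu.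
    exact: (measurableT_comp (measurable_mx_entry _ _)).
  under eq_fun do rewrite col_mxEd.
  exact: (measurableT_comp (measurable_mx_entry _ _)).
have mg : measurable_fun [set: 'cV[R[i]]_(k + l)]
  (fun v => (usubmx v, dsubmx v)).
  apply/measurable_fun_pair; apply/measurable_fun_mxP => i j /=;
    under eq_fun do rewrite mxE; exact: measurable_mx_entry.
have fK : cancel (fun z : 'cV[R[i]]_k * 'cV[R[i]]_l => col_mx z.1 z.2)
    (fun v => (usubmx v, dsubmx v)).
  by move=> [x y]; rewrite col_mxKu col_mxKd.
pose mu : {sigma_finite_measure set ('cV[R[i]]_k * 'cV[R[i]]_l)%type -> \bar R}
  :=
  HB.pack (@mx_lebesgue_measure R k 1 \x @mx_lebesgue_measure R l 1)%E
   (Measure_isSigmaFinite.Build _ _ _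
     (@mx_lebesgue_measure R k 1 \x @mx_lebesgue_measure R l 1)%E
     (sigma_finite_product (@mx_lebesgue_measure R k 1)
       (@mx_lebesgue_measure R l 1))).
have muE : (mu : set _ -> \bar R) =
  (@mx_lebesgue_measure R k 1 \x @mx_lebesgue_measure R l 1)%E by [].
rewrite -muE (@tinv_image_unique R (k + l) 1 _ _ mu _ _ mf mg fK)//.
  rewrite muE (_ : _ @^-1` _ = mxcube 1 `*` mxcube 1).
    rewrite product_measure1E//; [|exact: measurable_mxcube..].
    by rewrite [X in (X * _ * _)%E]mx_lebesgue_mxcube//
      [X in (_ * X * _)%E]mx_lebesgue_mxcube// !expr1n !mul1e.
  apply/seteqP; split=> -[x y] /=.
    move=> xy; split=> i j; first by have := xy (lshift l i) j;
      rewrite col_mxEu.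
    by have := xy (rshift k i) j; rewrite col_mxEd.
  move=> [x1 y1] i j; have [i' ->|i' ->] := split_ordP i;
    first by rewrite col_mxEu.
  by rewrite col_mxEd.
move=> D B mB; rewrite muE.
have [_ E] := pushes_to_prod (mx_lebesgue_translation (usubmx D))
  (mx_lebesgue_translation (dsubmx D)).
rewrite -[RHS]E; last by rewrite -[X in measurable X]setTI; exact: mf.
congr (_ _); apply/funext => -[x y] /=.
by rewrite /preimage /= -add_col_mx vsubmxK.
Qed.

End linear_images.

(** * Squared norms of uniform points of the ball *)

Section beta_law.
Context (R : realType).
Local Notation leb := (@lebesgue_measure R).

Lemma ge0_integral_pushes_to d1 d2 (T1 : measurableType d1)
    (T2 : measurableType d2) (mu : {measure set T1 -> \bar R})
    (nu : {measure set T2 -> \bar R}) (phi : T1 -> T2) (f : T2 -> \bar R) :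
  pushes_to mu nu phi -> measurable_fun [set: T2] f -> (forall y, 0 <= f y)%E ->
  (\int[nu]_y f y = \int[mu]_x f (phi x))%E.
Proof.
move=> [mphi phiE] mf f0.
have -> : (\int[nu]_y f y = \int[pushforward mu phi]_y f y)%E.
  by apply: eq_measure_integral => // A mA _; rewrite -phiE.
by rewrite ge0_integral_pushforward// preimage_setT.
Qed.

Lemma ge0_integral_translation (c : R) (f : R -> \bar R) :
  measurable_fun [set: R] f -> (forall x, 0 <= f x)%E ->
  (\int[leb]_x f (x + c)%R = \int[leb]_x f x)%E.
Proof.
by move=> mf f0; rewrite [RHS](ge0_integral_pushes_to (lebesgue_translation c)).
Qed.

Lemma ge0_integral_scaling (s : R) (f : R -> \bar R) : 0 < s ->
  measurable_fun [set: R] f -> (forall x, 0 <= f x)%E ->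
  (\int[leb]_x f x = s%:E * \int[leb]_x f (s * x)%R)%E.
Proof.
move=> s0 mf f0.
have := ge0_integral_pushes_to (lebesgue_scaling (PosNum s0)) mf f0 => /= <-.
rewrite ge0_integral_mscale//= muleA -EFinM divff ?mul1e// gt_eqF//.
Qed.

(** The substitution [x -> s x] maps the mass below [s] to [s * s^(k-1)] times the total mass, which
    is 1; the normalising constant never appears. *)
Lemma beta_prob_le (k : nat) (r : R) : (0 < k)%N -> 0 <= r <= 1 ->
  beta_prob k 1 `]-oo, r]%classic = (r ^+ k)%:E.
Proof.
move=> k0.
have pos (s : R) : 0 < s -> s <= 1 -> beta_prob k 1 `]-oo, s]%classic =
  (s ^+ k)%:E.
  move=> s0 s1; rewrite -integral_beta_pdf// integral_mkcond.
  rewrite (ge0_integral_scaling s0); last 2 first.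
  - apply/(measurable_restrictT _ _).1 => //.
    apply/measurable_EFinP. apply: measurable_funTS. exact: measurable_beta_pdf.
  - by move=> x; rewrite patchE; case: ifP => // _;
    rewrite lee_fin beta_pdf_ge0.
  have E x : ((fun x => (beta_pdf k 1 x)%:E) \_ `]-oo, s]) (s * x)%R =
      ((s ^+ k.-1)%:E * (beta_pdf k 1 x)%:E :> \bar R)%E.
    rewrite patchE mem_setE in_itv /= ger_pMr// /beta_pdf !patchE !mem_setE
      !in_itv /=.
    rewrite pmulr_rge0//; case: (leP x 1) => x1 /=; last first.
      by rewrite andbF mul0r mule0.
    have -> : s * x <= 1 by apply: le_trans s1; rewrite ger_pMr.
    rewrite !andbT.
    case: ifP => _; last by rewrite mul0r mule0.
    by rewrite -EFinM /XMonemX !expr0 !mulr1 exprMn mulrA.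
  under eq_integral do rewrite E.
  rewrite ge0_integralZl//; last 3 first.
  - apply/measurable_EFinP; exact: measurable_beta_pdf.
  - by move=> x _; rewrite lee_fin beta_pdf_ge0.
  - by rewrite lee_fin exprn_ge0// ltW.
  rewrite integral_beta_pdf// [X in (_ * (_ * X))%E](@probability_setT _ _ _
    (beta_prob k 1)).
  by rewrite mule1 -EFinM -exprS prednK.
move=> /andP[]; rewrite le_eqVlt => /predU1P[<- _|r0 r1]; last exact: pos.
rewrite expr0n eqn0Ngt k0; apply/eqP; rewrite eq_le measure_ge0 andbT.
(* The mass below 0 is at most [s^k <= s <= e] for [s = min(e, 1)]. *)
apply/lee_addgt0Pr => e e0; rewrite add0e.
pose s := Num.min e 1.
have s0 : 0 < s by rewrite lt_min e0 ltr01.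
have s1 : s <= 1 by rewrite ge_min lexx orbT.
apply: (@le_trans _ _ (beta_prob k 1 `]-oo, s]%classic)).
  apply: le_measure; rewrite ?inE//; apply: subset_itvl; rewrite bnd_simp;
    exact: ltW.
rewrite pos// lee_fin (@le_trans _ _ s)// ?ge_min ?lexx//.
by rewrite -(prednK k0) exprS ger_pMr// exprn_ile1// ltW.
Qed.

End beta_law.

Section ball_law.
Context (R : realType).
Local Notation leb := (@lebesgue_measure R).
Local Notation mleb := (@mx_lebesgue_measure R _ _).

Lemma measurable_itvNyc :
  @measurable _ (measurableTypeR R) =
  <<s [set A : set (measurableTypeR R) | exists r, A = `]-oo, r]%classic] >>.
Proof.
apply/seteqP; split; last first.
  apply: smallest_sub; first exact: sigma_algebra_measurable.
  by move=> _ [r ->]; exact: measurable_itv.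
rewrite [X in X `<=` _]RGenOInfty.measurableE.
apply: smallest_sub; first exact: smallest_sigma_algebra.
move=> _ [r ->]; rewrite -setCitvl; apply: sigma_algebraC.
by apply: sub_sigma_algebra; exists r.
Qed.

(** The ball of squared radius [r <= 1] has volume [c r^k], which is [c] times the distribution
    function of [B(k, 1)]; closed left half-lines form a generating pi-system. *)
Lemma ball_normsq_law k (c : {nonneg R}) : (0 < k)%N ->
  mleb (@mxball R k 1 1) = c%:num%:E ->
  pushes_to (mrestr (@mx_lebesgue_measure R k 1) (@measurable_mxball R k 1 1))
    (mscale c (beta_prob k 1)) (@normsq R k 1).
Proof.
move=> k0 cE.
have mN : measurable_fun [set: 'cV[R[i]]_k] (@normsq R k 1).
  by apply: measurable_normsq; exact: measurable_id.
split=> // A mA.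
pose mr := mrestr (@mx_lebesgue_measure R k 1) (@measurable_mxball R k 1 1).
pose N : 'cV[R[i]]_k -> measurableTypeR R := @normsq R k 1.
apply/esym; rewrite -[RHS]/(pushforward mr N A).
apply: (measure_unique [set A : set (measurableTypeR R) | exists r, A = `]-oo,
  r]%classic]
  (fun n => `]-oo, n%:R]%classic)) => //.
- exact: measurable_itvNyc.
- move=> _ _ [r ->] [s ->]; exists (Num.min r s).
  apply/seteqP; split=> x /=; rewrite !in_itv /= le_min.
    by move=> [-> ->].
  by move=> /andP.
- by move=> n; exists n%:R.
- apply/seteqP; split=> // x _; exists (Num.truncn `|x|).+1 => //=.
  by rewrite in_itv /= (le_trans (ler_norm _))// ltW// truncnS_gt.
- move=> _ [r ->]; rewrite -[LHS]/(c%:num%:E * beta_prob k 1 `]-oo,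
  r]%classic)%E -[RHS]/(mr (N @^-1` `]-oo, r]%classic)) /mr /mrestr.
  have [r0|r0] := ltP r 0.
    rewrite (_ : _ `&` _ = set0) ?measure0; last first.
      rewrite -subset0 => x [] /=; rewrite in_itv /= => xr _.
      by have := lt_le_trans r0 (normsq_ge0 x); rewrite ltNge xr.
    rewrite [X in (_ * X)%E](_ : _ = 0%E) ?mule0//.
    apply/eqP; rewrite eq_le measure_ge0 andbT.
    apply: (@le_trans _ _ (beta_prob k 1 `]-oo, 0%R]%classic)).
      by apply: le_measure; rewrite ?inE//; apply: subset_itvl;
        rewrite bnd_simp ltW.
    have -> := @beta_prob_le R k 0 k0; last by rewrite lexx ler01.
    by rewrite expr0n eqn0Ngt k0.
  have [r1|r1] := leP r 1.
    rewrite [X in (_ * X)%E](_ : _ = (r ^+ k)%:E); last first.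
      by apply: beta_prob_le => //; rewrite r0.
    rewrite (_ : _ `&` _ = mxball r); last first.
      apply/seteqP; split=> x; rewrite /mxball /= in_itv /=; first by case.
      by move=> xr; split=> //; exact: le_trans r1.
    by rewrite [RHS]mx_lebesgue_mxball ?mul1n// cE muleC.
  rewrite (_ : _ `&` _ = mxball 1); last first.
    apply/setIidPr => x; rewrite /mxball /= in_itv /= => x1.
    by rewrite (le_trans x1)// ltW.
  rewrite [RHS]cE [X in (_ * X)%E](_ : _ = 1%E) ?mule1//.
  apply/eqP; rewrite eq_le probability_le1//=.
  have <- : beta_prob k 1 `]-oo, (1 : R)]%classic = 1%E.
    by rewrite beta_prob_le ?expr1n// ler01 lexx.
  by apply: le_measure; rewrite ?inE//; apply: subset_itvl;
    rewrite bnd_simp ltW.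
- move=> n; rewrite /mscale /= ltey_eq fin_numM//.
  by apply: fin_num_measure.
Qed.

End ball_law.

(** * The proportion [a / (a + b)] under a product of beta laws *)

Section beta_product.
Context (R : realType).
Local Notation leb := (@lebesgue_measure R).

Lemma measurable_EFin_beta_pdf d (T : measurableType d) a b (f : T -> R) :
  measurable_fun [set: T] f ->
  measurable_fun [set: T] (fun x => (beta_pdf a b (f x))%:E : \bar R).
Proof.
move=> mf; apply/measurable_EFinP.
by apply: (@measurableT_comp _ _ _ _ _ _ (@beta_pdf R a b)) => //;
  exact: measurable_beta_pdf.
Qed.

(** Strict positivity of the sum excludes the quotient 0/0. The bounds on each coordinate place the
    sections inside the unit balls to which Lebesgue measure is restricted. *)
Definition ratio_region (E : set R) : set (R * R) :=
  [set z | [/\ 0 < z.1 + z.2, z.1 + z.2 <= 1, z.1 <= 1,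
    z.2 <= 1 & E (z.1 / (z.1 + z.2))]].

Lemma measurable_ratio_region (E : set (measurableTypeR R)) :
  measurable E -> measurable (ratio_region E : set
    (measurableTypeR R * measurableTypeR R)).
Proof.
move=> mE; pose T := (measurableTypeR R * measurableTypeR R)%type.
have m1 : measurable_fun [set: T] (fun z : T => z.1 : R) by exact:
  measurable_fst.
have m2 : measurable_fun [set: T] (fun z : T => z.2 : R) by exact:
  measurable_snd.
have ms : measurable_fun [set: T] (fun z : T => z.1 + z.2 : R) by exact:
  measurable_funD.
have pm (f : T -> R) (C : set R) : measurable_fun [set: T] f ->
    measurable (C : set (measurableTypeR R)) -> measurable (f @^-1` C).
  by move=> mf mC; rewrite -[X in measurable X]setTI; exact: mf.
rewrite (_ : ratio_region E =
  (fun z : T => z.1 + z.2) @^-1` `]0, 1] `&` ((fun z : T => z.1) @^-1` `]-oo,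
    1] `&`
   ((fun z : T => z.2) @^-1` `]-oo, 1] `&` (fun z : T => z.1 / (z.1 + z.2))
     @^-1` E))).
  apply: measurableI; first exact: pm.
  apply: measurableI; first exact: pm.
  apply: measurableI; first exact: pm.
  by apply: pm => //; apply: measurable_funM => //; exact: measurable_invr.
apply/seteqP; split=> -[a b]; rewrite /ratio_region /= !in_itv /=.
  by move=> [-> -> -> ->].
by move=> [/andP[-> ->] [-> [-> ]]].
Qed.

(** With second parameter 1 the densities are pure powers on the unit interval, so in the
    coordinates [a = s t], [b = s (1 - t)] the joint density splits into a function of [s] and the
    [B(k, l)] density of [t]. *)
Lemma beta_pdf_ratio k l (s t : R) : 0 < s <= 1 ->
  beta_pdf k 1 (s * t) * beta_pdf l 1 (s - s * t) =
  s ^+ k.-1 * s ^+ l.-1 * (beta_fun k l / (beta_fun k 1 * beta_fun l 1)) *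
  beta_pdf k l t :> R.
Proof.
move=> /andP[s0 s1]; rewrite -{2}(mulr1 s) -mulrBr /beta_pdf !patchE !mem_setE
  !in_itv /=.
rewrite !pmulr_rge0// subr_ge0.
have B0 a b : beta_fun a b != 0 :> R by rewrite gt_eqF// beta_fun_gt0.
have [t0|t0] := leP 0 t; last by rewrite /= !(mul0r, mulr0).
have [t1|t1] := leP t 1; last by rewrite /= !(mul0r, mulr0).
have -> : s * t <= 1 by apply: mulr_ile1 => //; exact: ltW.
have -> : s * (1 - t) <= 1 by apply: mulr_ile1; rewrite ?subr_ge0 ?gerBl//;
  exact: ltW.
rewrite /= /XMonemX !expr0 !mulr1 !exprMn.
by field; rewrite !B0.
Qed.

Lemma beta_prob_ratio k l : (0 < k)%N -> (0 < l)%N ->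
  exists C : \bar R, forall E : set (measurableTypeR R), measurable E ->
    (beta_prob k 1 \x beta_prob l 1)%E (ratio_region E) =
      (C * beta_prob k l E)%E.
Proof.
move=> k0 l0.
(* The density of the sum [s]; its leading factor [s] is the Jacobian of [a = s t]. *)
pose h (s : R) : \bar R := (\1_(`]0, 1]%classic : set R) s *
  (s * (s ^+ k.-1 * s ^+ l.-1 *
   (beta_fun k l / (beta_fun k 1 * beta_fun l 1)))))%:E.
exists (\int[leb]_s h s)%E => E mE.
pose S := ratio_region E; have mS := measurable_ratio_region mE.
pose w (z : R * R) : \bar R :=
  (\1_S z * beta_pdf k 1 z.1 * beta_pdf l 1 z.2)%:E.
have w0 z : (0 <= w z)%E.
  rewrite lee_fin; apply: mulr_ge0; last exact: beta_pdf_ge0.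
  by apply: mulr_ge0; last exact: beta_pdf_ge0.
have mw : measurable_fun [set: measurableTypeR R * measurableTypeR R] w.
  apply/measurable_EFinP; apply: measurable_funM; first apply: measurable_funM.
  - exact: measurable_indic.
  - apply: (measurableT_comp (f := @beta_pdf R k 1));
    last exact: measurable_fst.
    exact: measurable_beta_pdf.
  - apply: (measurableT_comp (f := @beta_pdf R l 1));
    last exact: measurable_snd.
    exact: measurable_beta_pdf.
have mshear : measurable_fun [set: measurableTypeR R * measurableTypeR R]
    (fun z => (z.1, z.2 - z.1) : measurableTypeR R * measurableTypeR R).
  apply/measurable_fun_pair; first exact: measurable_fst.
  by apply: measurable_funB; [exact: measurable_snd|exact: measurable_fst].
transitivity (\int[leb]_a \int[leb]_b w (a, b))%E.
  rewrite /product_measure1.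
  rewrite (integral_beta_prob (f := fun a => beta_prob l 1 (xsection S a)))//;
    last 2 first.
  - exact: measurable_fun_xsection.
  - apply: (@le_lt_trans _ _ (\int[beta_prob k 1]_x 1)%E).
      apply: ge0_le_integral => //.
      + by apply: measurableT_comp => //; exact: measurable_fun_xsection.
      + by move=> x _; rewrite gee0_abs// probability_le1//;
        exact: measurable_xsection.
    by rewrite integral_cst// mul1e (le_lt_trans (probability_le1 _ _)) ?ltry.
  apply: eq_integral => a _; rewrite -integral_beta_pdf;
    last exact: measurable_xsection.
  rewrite integral_mkcond muleC -ge0_integralZl//; last 3 first.
  - apply/(measurable_restrictT _ _).1; first exact: measurable_xsection.
    by apply: measurable_funTS; apply: measurable_EFin_beta_pdf.
  - by move=> x _; rewrite patchE; case: ifP => // _;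
    rewrite lee_fin beta_pdf_ge0.
  - by rewrite lee_fin beta_pdf_ge0.
  apply: eq_integral => b _; rewrite patchE mem_xsection /w indicE /=.
  case: ifP => _; first by rewrite mul1r EFinM.
  by rewrite !mul0r mule0.
(* Change of variable [b = s - a]; after Tonelli, [a = s t] is substituted for each fixed [s]. *)
transitivity (\int[leb]_a \int[leb]_s w (a, (s - a)%R))%E.
  apply: eq_integral => a _.
  rewrite [RHS](ge0_integral_translation (- a) (f := fun b => w (a, b)))//.
  exact: measurableT_comp mw (measurable_pair1 a).
rewrite (@fubini_tonelli _ _ _ _ _ leb leb (fun z => w (z.1, z.2 - z.1)))//;
  last first.
  exact: measurableT_comp mw mshear.
rewrite -ge0_integralZr//; last 2 first.
- apply/measurable_EFinP; apply: measurable_funM; first exact: measurable_indic.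
  apply: measurable_funM => //; apply: measurable_funM => //.
  by apply: measurable_funM; exact: measurable_funX.
- move=> s _; rewrite /h lee_fin indicE.
  have [|_] := boolP (s \in _); last by rewrite mul0r.
  rewrite mem_setE in_itv /= => /andP[s0 _].
  have s0' := ltW s0.
  by rewrite mul1r !mulr_ge0 ?exprn_ge0 ?invr_ge0 ?mulr_ge0 ?beta_fun_ge0.
apply: eq_integral => s _ /=; rewrite /h indicE.
have [|s01] := boolP (s \in _); last first.
  rewrite mul0r mul0e integral0_eq// => a _; rewrite /w indicE memNset ?mul0r//.
  by rewrite /S /ratio_region /= addrC subrK => -[s0 s1 _ _ _]; move: s01;
    rewrite mem_setE in_itv /= s0 s1.
rewrite mem_setE in_itv /= => /andP[s0 s1].
rewrite (ge0_integral_scaling s0); last 2 first.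
- exact: measurableT_comp (measurableT_comp mw mshear) (measurable_pair2 s).
- by [].
have wE t : w (s * t, s - s * t) =
    ((s ^+ k.-1 * s ^+ l.-1 * (beta_fun k l /
      (beta_fun k 1 * beta_fun l 1)))%:E *
     ((fun t => (beta_pdf k l t)%:E) \_ E) t)%E.
  have := @beta_pdf_ratio k l s t; rewrite s0 s1 => /(_ isT) pE.
  rewrite patchE; case: ifPn => tE; last first.
    rewrite mule0 /w indicE memNset ?mul0r//.
    rewrite /S /ratio_region /= addrC subrK mulrAC divff ?gt_eqF// mul1r.
    by move=> [_ _ _ _]; move: tE; rewrite notin_setE.
  rewrite -EFinM -pE /w /=.
  (* For [t] in the unit interval the point lies in the region; elsewhere the beta density
     vanishes. *)
  have [/andP[t0 t1]|t01] := boolP (0 <= t <= 1).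
    rewrite indicE mem_set ?mul1r//.
    rewrite /S /ratio_region /= addrC subrK mulrAC divff ?gt_eqF// mul1r.
    split=> //; last by rewrite inE in tE.
      by apply: mulr_ile1 => //; exact: ltW.
    by rewrite -{1}(mulr1 s) -mulrBr; apply: mulr_ile1;
      rewrite ?subr_ge0 ?gerBl//; exact: ltW.
  rewrite -mulrA pE (_ : beta_pdf k l t = 0) ?mulr0//.
  by rewrite /beta_pdf patchE mem_setE in_itv /= (negPf t01) mul0r.
under eq_integral do rewrite wE.
rewrite ge0_integralZl//; last 3 first.
- apply/(measurable_restrictT _ _).1 => //.
  by apply: measurable_funTS; apply: measurable_EFin_beta_pdf.
- by move=> x _; rewrite patchE; case: ifP => // _;
  rewrite lee_fin beta_pdf_ge0.
- have s0' := ltW s0.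
  by rewrite lee_fin !mulr_ge0 ?exprn_ge0 ?invr_ge0 ?mulr_ge0 ?beta_fun_ge0.
by rewrite -integral_mkcond integral_beta_pdf// mul1r EFinM muleA.
Qed.

End beta_product.

(** * Share of the first coordinates in the norm of a uniform point of the ball *)

Section ball_ratio.
Context (R : realType).
Local Notation mleb := (@mx_lebesgue_measure R _ _).

Definition punctured_ball {n} : set 'cV[R[i]]_n := [set v | 0 < normsq v <= 1].

Lemma measurable_punctured_ball n : measurable (@punctured_ball n).
Proof.
rewrite (_ : punctured_ball = (@normsq R n 1) @^-1` `]0, 1]).
  rewrite -[X in measurable X]setTI; apply: measurable_normsq => //.
by apply/seteqP; split=> v; rewrite /punctured_ball /= in_itv.
Qed.

Lemma punctured_ball_lty n : (mleb (@punctured_ball n) < +oo)%E.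
Proof.
apply: le_lt_trans (@mxball_lty R n 1); apply: le_measure; rewrite ?inE.
- exact: measurable_punctured_ball.
- exact: measurable_mxball.
- by move=> v /andP[].
Qed.

Lemma punctured_ball_gt0 n : (0 < n)%N -> (0 < mleb (@punctured_ball n))%E.
Proof.
move=> n0; apply: (lt_le_trans (@mxball_gt0 R n 1)).
apply: (@le_trans _ _ (mleb (@punctured_ball n `|` @mxball R n 1 0))).
  apply: le_measure; rewrite ?inE.
  - exact: measurable_mxball.
  - by apply: measurableU; [exact: measurable_punctured_ball|exact:
    measurable_mxball].
  - move=> v v1; have [v0|v0] := leP (normsq v) 0; first by right.
    by left; rewrite /punctured_ball /= v0.
apply: le_trans (measureU2 _ _ _) _.
- exact: measurable_punctured_ball.
- exact: measurable_mxball.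
by rewrite [X in (_ + X)%E]mx_lebesgue_mxball ?mul1n// expr0n eqn0Ngt n0 mul0e
  adde0.
Qed.

Lemma measurable_usubmx d (T : measurableType d) k l
  (f : T -> 'cV[R[i]]_(k + l)) :
  measurable_fun [set: T] f -> measurable_fun [set: T] (fun x => usubmx (f x)).
Proof.
move=> /measurable_fun_mxP mf; apply/measurable_fun_mxP => i j.
by under eq_fun do rewrite mxE; exact: mf.
Qed.

Lemma measurable_normsq_ratio d (T : measurableType d) k l
  (f : T -> 'cV[R[i]]_(k + l)) :
  measurable_fun [set: T] f ->
  measurable_fun [set: T] (fun x => normsq (usubmx (f x)) / normsq (f x)).
Proof.
move=> mf; apply: measurable_funM;
  first exact/measurable_normsq/measurable_usubmx.
exact/measurable_invr/measurable_normsq.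
Qed.

Lemma ball_ratio_law k l (E : set (measurableTypeR R)) : (0 < k)%N ->
  (0 < l)%N ->
  measurable E ->
  mleb [set v : 'cV[R[i]]_(k + l) |
    punctured_ball v /\ E (normsq (usubmx v) / normsq v)] =
  (mleb (@punctured_ball (k + l)) * beta_prob k l E)%E.
Proof.
move=> k0 l0.
(* Proportionality is enough: [F = setT] identifies [C] as the volume of the punctured ball. *)
suff [C CE] : exists C : \bar R, forall F : set (measurableTypeR R),
  measurable F ->
    mleb [set v : 'cV[R[i]]_(k + l) |
      punctured_ball v /\ F (normsq (usubmx v) / normsq v)] =
        (C * beta_prob k l F)%E.
  move=> mE; rewrite CE//; congr (_ * _)%E.
  have := CE setT measurableT; rewrite
    [X in (_ * X)%E](@probability_setT _ _ _ (beta_prob k l)) mule1 => <-.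
  by congr (_ _); apply/seteqP; split=> v // [].
have [C0 C0E] := beta_prob_ratio R k0 l0.
have ball_fin n : exists c : {nonneg R}, mleb (@mxball R n 1 1) = c%:num%:E.
  have c0 : 0 <= fine (mleb (@mxball R n 1 1)) by apply/fine_ge0/measure_ge0.
  exists (NngNum c0) => /=; rewrite fineK//.
  by rewrite ge0_fin_numE ?measure_ge0//; exact: mxball_lty.
have [ck ckE] := ball_fin k; have [cl clE] := ball_fin l.
exists (cl%:num%:E * (ck%:num%:E * C0))%E => F mF.
have [mNk Nk] := ball_normsq_law k0 ckE.
have [mNl Nl] := ball_normsq_law l0 clE.
pose S := ratio_region F; have mS := measurable_ratio_region mF.
pose lk := @mx_lebesgue_measure R k 1; pose ll := @mx_lebesgue_measure R l 1.
rewrite mx_lebesgue_col_mx; last first.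
  apply: measurableI; first exact: measurable_punctured_ball.
  rewrite -[X in measurable X]setTI.
  exact: (measurable_normsq_ratio (@measurable_id _ _ _)).
pose A : set ('cV[R[i]]_k * 'cV[R[i]]_l) :=
  [set z | S (normsq z.1, normsq z.2)].
rewrite (_ : _ @^-1` _ = A); last first.
  apply/seteqP; split=> -[v w]; rewrite /A /S /ratio_region /punctured_ball /=
    normsq_col_mx col_mxKu.
    move=> [/andP[s0 s1] vF]; split=> //.
      by rewrite (le_trans _ s1)// lerDl normsq_ge0.
    by rewrite (le_trans _ s1)// lerDr normsq_ge0.
  by move=> [-> -> _ _ vF].
(* Intermediate stage: the second block has already been replaced by its squared norm, while the
   first is still a vector. *)
pose B : set ('cV[R[i]]_k * measurableTypeR R) := [set z | S (normsq z.1, z.2)].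
have mB : measurable B.
  rewrite -[B]setTI; apply: (_ : measurable_fun setT
    (fun z => (normsq z.1, z.2) : measurableTypeR R * measurableTypeR R)) => //.
  apply/measurable_fun_pair => //.
  exact: (measurableT_comp (measurable_normsq (@measurable_id _ _ _))
    measurable_fst).
transitivity (cl%:num%:E * (lk \x beta_prob l 1) B)%E.
  rewrite /product_measure1 -ge0_integralZl//; last first.
    exact: measurable_fun_xsection.
  apply: eq_integral => v _ /=.
  transitivity (mrestr ll (@measurable_mxball R l 1 1)
    (@normsq R l 1 @^-1` (xsection S (normsq v)))).
    rewrite /mrestr; congr (_ _); apply/seteqP; split=> w;
      rewrite /xsection /= !inE /A /=.
      by move=> wS; split=> //; case: wS.
    by case.
  rewrite Nl; last exact: measurable_xsection.
  transitivity (cl%:num%:E * beta_prob l 1 (xsection S (normsq v)))%E;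
    first by [].
  congr (_ * _)%E; congr (_ _).
rewrite -muleA; congr (_ * _)%E.
rewrite product_measure_swap//.
transitivity (ck%:num%:E * (beta_prob k 1 \x^ beta_prob l 1) S)%E.
  rewrite /product_measure2 -ge0_integralZl//; last first.
    exact: measurable_fun_ysection.
  apply: eq_integral => b _ /=.
  transitivity (mrestr lk (@measurable_mxball R k 1 1)
    (@normsq R k 1 @^-1` (ysection S b))).
    rewrite /mrestr; congr (_ _); apply/seteqP; split=> w;
      rewrite /ysection /= !inE /B /=.
      by move=> wS; split=> //; case: wS.
    by case.
  by rewrite Nk; last exact: measurable_ysection.
by rewrite -product_measure_swap// C0E// muleA.
Qed.

End ball_ratio.

(** * Averaging over the generic matrices *)

Section generic_matrices.
Context (R : realType).
Local Notation leb := (@lebesgue_measure R).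
Local Notation mleb := (@mx_lebesgue_measure R _ _).

(** [\det (A + t I)] is the characteristic polynomial of [- A] at [t], so [t] is the real part of
    one of its finitely many roots. *)
Lemma det_shift_eq0_finite q (A : 'M[R[i]]_q) :
  finite_set [set t : R | \det (A + (t%:C)%:M) = 0].
Proof.
have [r rE] := closed_field_poly_normal (char_poly (- A)).
rewrite (monicP (char_poly_monic _)) scale1r in rE.
apply: (@sub_finite_set _ _ [set` [seq complex.Re z | z <- r]]);
  last exact: finite_seq.
move=> t /= At0; apply/mapP; exists t%:C => //.
rewrite -root_prod_XsubC -rE; apply/rootP.
rewrite /char_poly -horner_evalE -det_map_mx -[RHS]At0; congr (\det _).
apply/matrixP => i j; rewrite !mxE /= horner_evalE !hornerE /=.
by rewrite hornerMn hornerX opprK addrC.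
Qed.

(* Integrate over the translates of the zero set along the line [t D], which it
   meets in finitely many points. *)
Lemma mx_lebesgue_det_null m n q (E : 'M[R[i]]_(q, m)) (F : 'M[R[i]]_(n, q))
    (D : 'M[R[i]]_(m, n)) : E *m D *m F = 1%:M ->
  mleb [set Z : 'M[R[i]]_(m, n) | \det (E *m Z *m F) = 0] = 0%E.
Proof.
move=> EDF; set N := [set Z | _].
have mN : measurable N.
  apply: measurable_det_eq0; apply: measurable_mulmx => //.
  by apply: measurable_mulmx => //; exact: measurable_cst.
pose ml := @mx_lebesgue_measure R m n.
pose Q : set (measurableTypeR R * 'M[R[i]]_(m, n)) :=
  fst @^-1` `]0, 1]%classic `&` (fun z => z.2 + (z.1 : R)%:C *: D) @^-1` N.
have mQ : measurable Q.
  apply: measurableI; rewrite -[X in measurable X]setTI.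
    by apply: measurable_fst.
  apply: (_ : measurable_fun setT
    (fun z : measurableTypeR R * 'M[R[i]]_(m, n) => z.2 + (z.1 : R)%:C *: D))
    => //.
  apply: measurable_mxD; first exact: measurable_snd.
  apply: measurable_scalemx => //.
  by apply: measurable_real_complex; exact: measurable_fst.
have Q1 : (leb \x ml)%E Q = ml N.
  transitivity (\int[leb]_t ml (xsection Q t))%E; first by [].
  rewrite (eq_integral (fun t : measurableTypeR R =>
    (\1_(`]0, 1]%classic : set (measurableTypeR R)) t)%:E * ml N)%E) => [|t _].
    rewrite ge0_integralZr ?integral_indic ?setIT//.
      rewrite [X in (X * _)%E](_ : _ = 1%E) ?mul1e//.
      by rewrite [LHS]lebesgue_measure_itv /= lte01 oppr0 adde0.
    exact/measurable_EFinP/measurable_indic.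
  rewrite indicE /=; have [t01|t01] := boolP (t \in _).
    rewrite mul1e; have [_ tE] := mx_lebesgue_translation (t%:C *: D).
    rewrite -[RHS]tE//.
    congr (_ _); apply/seteqP; split=> Z; rewrite /xsection /= inE /Q /=.
      by case.
    by split=> //; rewrite inE in t01.
  rewrite mul0e (_ : xsection _ _ = set0) ?measure0// -subset0 => Z.
  by rewrite /xsection /= inE /Q /= => -[t01' _]; move: t01; rewrite notin_setE.
rewrite -[LHS]Q1 product_measure_swap// /product_measure2 integral0_eq// =>
  Z _ /=.
apply/eqP; rewrite eq_le measure_ge0 andbT.
rewrite -(countable_lebesgue_measure0
  (finite_set_countable (det_shift_eq0_finite (E *m Z *m F)))).
apply: le_measure; rewrite ?inE; first exact: measurable_ysection.
  apply: countable_measurable => [t|]; first exact: measurable_set1.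
  exact/finite_set_countable/det_shift_eq0_finite.
move=> t; rewrite /ysection /= inE /Q /= => -[_]; rewrite /N /=.
by rewrite mulmxDr mulmxDl -scalemxAr -scalemxAl EDF scalemx1.
Qed.

Lemma measurable_crb_ratio d (T : measurableType d) n q N m
  (X : 'M[R[i]]_(n, q))
    (W : 'M[R[i]]_(n, N)) (Z : T -> 'M[R[i]]_(m, n)) (v : T -> 'cV[R[i]]_N) :
  measurable_fun [set: T] Z -> measurable_fun [set: T] v ->
  measurable_fun [set: T] (fun x => crb_ratio X W (Z x) (v x)).
Proof.
move=> mZ mv.
have cst a b (A : 'M[R[i]]_(a, b)) : measurable_fun [set: T] (fun _ => A).
  exact: measurable_cst.
have mP : measurable_fun [set: T] (fun x => proj_adj (Z x)).
  apply: measurable_mulmx => //; apply: measurable_mulmx;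
    first exact: measurable_trmxC.
  apply: measurable_invmx; apply: measurable_mulmx => //;
    exact: measurable_trmxC.
have mS : measurable_fun [set: T] (fun x => resid (proj_adj (Z x)) X).
  apply: measurable_mxD => //; apply: measurable_mxN.
  apply: measurable_mulmx => //; apply: measurable_mulmx => //.
  apply: measurable_mulmx; first exact: measurable_mulmx.
  by apply: measurable_invmx; apply: measurable_mulmx => //;
    exact: measurable_mulmx.
apply: measurable_cM; first exact/measurable_real_complex/measurable_normsq.
apply: measurable_cV.
have /measurable_fun_mxP : measurable_fun [set: T]
    (fun x => (v x) ^t* *m compressed_proj X W (Z x) *m v x).
  apply: measurable_mulmx => //; apply: measurable_mulmx;
    first exact: measurable_trmxC.
  by apply: measurable_mulmx => //; exact: measurable_mulmx.
by apply.
Qed.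

Definition compressible n q m (X : 'M[R[i]]_(n, q)) (Z : 'M[R[i]]_(m, n)) :
  Prop :=
  Z *m Z ^t* \in unitmx /\ X ^t* *m proj_adj Z *m X \in unitmx.

(* Both the law of [Z] and [crb_ratio] are unitarily covariant, so the integral
   below does not depend on [v0 != 0]; averaging it over [v0] in the punctured
   unit ball and using Tonelli, one is left with the law of [crb_ratio X W Z v]
   for a fixed [Z] and a random [v]. *)
Lemma crb_ratio_law n q k l m (X : 'M[R[i]]_(n, q)) (W : 'M[R[i]]_(n, k + l))
    (f : 'M[R[i]]_(m, n) -> R) (v0 : 'cV[R[i]]_(k + l)) (A : set R[i]) :
  (0 < k)%N -> (0 < l)%N -> m = (k + q)%N ->
  W ^t* *m W = 1%:M -> W ^t* *m X = 0 -> resid 1%:M X = W *m W ^t* ->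
  {ae (@mx_lebesgue_measure R m n), forall Z, compressible X Z} ->
  measurable_fun [set: 'M[R[i]]_(m, n)] f -> (forall Z, 0 <= f Z) ->
  (\int[@mx_lebesgue_measure R m n]_Z (f Z)%:E)%E = 1%E ->
  (forall U Z, U *m U ^t* = 1%:M -> f (Z *m U) = f Z) ->
  v0 != 0 -> measurable A ->
  (\int[@mx_lebesgue_measure R m n]_(Z in [set Z | A (crb_ratio X W Z v0)])
    (f Z)%:E)%E
  = inverse_law (beta_prob k l) A.
Proof.
move=> k0 l0 mkq WW WX WWX aeZ mf f0 f1 fU v00 mA.
pose lm := @mx_lebesgue_measure R m n; pose lv :=
  @mx_lebesgue_measure R (k + l) 1.
pose D := @punctured_ball R (k + l).
pose E : set (measurableTypeR R) := [set b | A ((b : R)^-1)%:C].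
have mE : measurable E.
  rewrite -[E]setTI.
  apply: (_ : measurable_fun [set: measurableTypeR R]
    (fun b : measurableTypeR R => ((b : R)^-1)%:C)) => //.
  exact/measurable_real_complex/measurable_invr.
rewrite -[RHS]/(beta_prob k l E).
pose T := ('cV[R[i]]_(k + l) * 'M[R[i]]_(m, n))%type.
pose S : set T := [set z | D z.1 /\ A (crb_ratio X W z.2 z.1)].
have mS : measurable S.
  apply: measurableI.
    by rewrite -[X in measurable X]setTI; apply: measurable_fst => //;
      exact: measurable_punctured_ball.
  rewrite -[X in measurable X]setTI.
  exact: (measurable_crb_ratio X W (@measurable_snd _ _ _ _)
    (@measurable_fst _ _ _ _)).
pose h (z : T) : \bar R := (\1_S z * f z.2)%:E.
have h0 z : (0 <= h z)%E by rewrite lee_fin mulr_ge0// indicE ler0n.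
have mh : measurable_fun [set: T] h.
  apply/measurable_EFinP; apply: measurable_funM; first exact: measurable_indic.
  exact: measurableT_comp mf measurable_snd.
set I0 := (LHS).
pose Iv v := (\int[lm]_(Z in [set Z | A (crb_ratio X W Z v)]) (f Z)%:E)%E.
have mZv v : measurable [set Z : 'M[R[i]]_(m, n) | A (crb_ratio X W Z v)].
  rewrite -[X in measurable X]setTI.
  exact: (measurable_crb_ratio X W (@measurable_id _ _ _)
    (@measurable_cst _ _ _ _ _ v)).
have Iconst v : v != 0 -> Iv v = I0.
  move=> vN0; have [U UU UE] := crb_ratio_transitive WW WX m v00 vN0.
  rewrite /I0 /Iv [RHS]integral_mkcond [LHS]integral_mkcond.
  rewrite [RHS](ge0_integral_pushes_to (@mx_lebesgue_mulr_unitary R m n U UU)).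
  - apply: eq_integral => Z _; rewrite !patchE fU//.
    by congr (if _ then _ else _); apply/idP/idP; rewrite !inE /= UE.
  - apply/(measurable_restrictT _ _).1 => //.
    by apply: measurable_funTS; exact/measurable_EFinP.
  - by move=> Z; rewrite patchE; case: ifP => // _; rewrite lee_fin.
have lhs : (\int[lv]_v \int[lm]_Z h (v, Z) = lv D * I0)%E.
  rewrite (eq_integral (fun v => (\1_D v)%:E * I0)%E) => [|v _].
    rewrite ge0_integralZr ?integral_indic ?setIT//.
    - exact: measurable_punctured_ball.
    - by apply/measurable_EFinP; apply: measurable_indic;
      exact: (@measurable_punctured_ball R (k + l)).
    - by apply: integral_ge0 => Z _; rewrite lee_fin.
  rewrite indicE; have [vD|vD] := boolP (v \in D).
    have vN0 : v != 0.
      by rewrite -normsq_gt0; move: vD; rewrite inE => /andP[].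
    rewrite mul1e -(Iconst v vN0) /Iv [RHS]integral_mkcond;
      apply: eq_integral => Z _.
    rewrite patchE /h indicE /=; case: ifPn => AZ.
      by rewrite mem_set ?mul1r//; split; [rewrite inE in vD|rewrite inE in AZ].
    by rewrite memNset ?mul0r// => -[_]; move: AZ; rewrite notin_setE.
  rewrite mul0e integral0_eq// => Z _; rewrite /h indicE memNset ?mul0r//.
  by move=> -[vD' _]; move: vD; rewrite notin_setE.
have rhs : (\int[lm]_Z \int[lv]_v h (v, Z) = lv D * beta_prob k l E)%E.
  transitivity (\int[lm]_Z ((f Z)%:E * (lv D * beta_prob k l E)))%E; last first.
    rewrite ge0_integralZr//.
    - by rewrite f1 mul1e.
    - exact/measurable_EFinP.
    - by move=> Z _; rewrite lee_fin.
    - by rewrite mule_ge0.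
  (* The unitary form of the ratio is available for compressible [Z] only, that is, almost
     everywhere. *)
  apply: ae_eq_integral => //.
  - exact: measurable_fun_fubini_tonelli_G.
  - by apply: emeasurable_funM => //; exact/measurable_EFinP.
  move: aeZ; apply: filterS => Z [ZZ XZ] _.
  have [Q QQ QE] := crb_ratio_unitary WWX mkq ZZ XZ.
  transitivity (\int[lv]_v ((f Z)%:E * (\1_(ysection S Z) v)%:E))%E.
    apply: eq_integral => v _; rewrite /h mulrC EFinM; congr (_ * _)%E.
    by rewrite !indicE mem_ysection.
  rewrite ge0_integralZl//; last 2 first.
  - exact/measurable_EFinP/measurable_indic/measurable_ysection.
  - by rewrite lee_fin.
  rewrite integral_indic ?setIT//; last exact: measurable_ysection.
  congr (_ * _)%E.
  rewrite -[RHS](@ball_ratio_law R k l E k0 l0 mE).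
  have [_ UE] := @mx_lebesgue_mull_unitary R (k + l) Q QQ.
  rewrite -[RHS]UE; last first.
    apply: measurableI; first exact: measurable_punctured_ball.
    rewrite -[X in measurable X]setTI.
    exact: (measurable_normsq_ratio (@measurable_id _ _ _)).
  congr (_ _); apply/seteqP; split=> v;
    rewrite /ysection /= inE /S /D /punctured_ball /= QE normsq_unitary//.
have := @fubini_tonelli _ _ _ _ _ lv lm h mh h0.
rewrite lhs rhs => e.
have Dfin : lv D \is a fin_num.
  by rewrite ge0_fin_numE ?measure_ge0//; exact: punctured_ball_lty.
have D0 : (0 < lv D)%E by apply: punctured_ball_gt0; rewrite addn_gt0 k0.
(* The volume [lv D] is finite and positive, so it cancels from the two iterated integrals. *)
apply/eqP; rewrite eq_le.
by rewrite -(lee_pmul2l Dfin D0) -[X in _ && X](lee_pmul2l Dfin D0) e lexx.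
Qed.

(** If the first [m] columns of [Z] form an invertible block, then [Z] has a right inverse, hence
    [Z^H] a left inverse. *)
Lemma ae_gram_unit m n : (m <= n)%N ->
  {ae (@mx_lebesgue_measure R m n), forall Z, Z *m Z ^t* \in unitmx}.
Proof.
move=> mn; exists [set Z : 'M[R[i]]_(m, n) | \det (1%:M *m Z *m pid_mx m) = 0];
  split.
- apply: measurable_det_eq0; apply: measurable_mulmx => //.
  by apply: measurable_mulmx => //; exact: measurable_cst.
- apply: (@mx_lebesgue_det_null _ _ _ _ _ (pid_mx m)).
  by rewrite mul1mx pid_mx_id// pid_mx_1.
move=> Z /= ZN; apply: contrapT => d0; apply: ZN.
have ZF : Z *m pid_mx m \in unitmx by rewrite unitmxE unitfE -[Z]mul1mx;
  apply/eqP.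
rewrite -[Z in Z *m _]trmxCK.
apply: (@inv_gram_unit _ _ _ _ ((pid_mx m *m invmx (Z *m pid_mx m)) ^t*)).
by rewrite -trmxCM mulmxA mulmxV// trmxC1.
Qed.

(** It suffices that the first [p] rows of [Z F] be independent; the determinant expressing this is
    1 at [Z = pid_mx p *m F']. *)
Lemma ae_left_inverse m n p (F : 'M[R[i]]_(n, p)) (F' : 'M[R[i]]_(p, n)) :
  (p <= m)%N -> F' *m F = 1%:M ->
  {ae (@mx_lebesgue_measure R m n), forall Z, exists Y, Y *m Z *m F = 1%:M}.
Proof.
move=> pm F'F.
exists [set Z : 'M[R[i]]_(m, n) | \det (pid_mx p *m Z *m F) = 0]; split.
- apply: measurable_det_eq0; apply: measurable_mulmx => //.
  by apply: measurable_mulmx => //; exact: measurable_cst.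
- apply: (@mx_lebesgue_det_null _ _ _ _ _ (pid_mx p *m F')).
  by rewrite mulmxA pid_mx_id// pid_mx_1 mul1mx.
move=> Z /= ZN; apply: contrapT => d0; apply: ZN.
exists (invmx (pid_mx p *m Z *m F) *m pid_mx p).
have U : pid_mx p *m Z *m F \in unitmx by rewrite unitmxE unitfE; apply/eqP.
by rewrite -[RHS](mulVmx U) !mulmxA.
Qed.

Lemma measurable_cramer_rao_ratio m n p (sigma2 : R) (G : 'M[R[i]]_(n, p))
  (i : 'I_p) :
  measurable_fun [set: 'M[R[i]]_(m, n)]
    (fun Z => cramer_rao (fisher_compressed sigma2 Z G) i / cramer_rao
      (fisher sigma2 G) i).
Proof.
have mid : measurable_fun [set: 'M[R[i]]_(m, n)] (fun Z : 'M[R[i]]_(m, n) => Z).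
  exact: measurable_id.
have cst a b (A : 'M[R[i]]_(a, b)) : measurable_fun [set: 'M[R[i]]_(m, n)]
  (fun _ => A).
  exact: measurable_cst.
apply: measurable_cM; last exact: measurable_cst.
apply: (_ : measurable_fun setT
  (fun Z => invmx (fisher_compressed sigma2 Z G) i i)).
have /measurable_fun_mxP : measurable_fun [set: 'M[R[i]]_(m, n)]
    (fun Z => invmx (fisher_compressed sigma2 Z G)).
  apply: measurable_invmx; apply: measurable_scalemx;
    first exact: measurable_cst.
  apply: measurable_mulmx => //; apply: measurable_mulmx => //.
  apply: measurable_mulmx => //; apply: measurable_mulmx;
    first exact: measurable_trmxC.
  apply: measurable_invmx; apply: measurable_mulmx => //;
    exact: measurable_trmxC.
by apply.
Qed.

End generic_matrices.

(** * Law of the ratio of Cramer-Rao bounds *)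

Lemma row'_col'1 (K : pzRingType) p (i : 'I_p) :
  row' i 1%:M *m col' i 1%:M = 1%:M :> 'M[K]_p.-1.
Proof.
rewrite row'Esub mul_rowsub_mx mul1mx; apply/matrixP => j k.
by rewrite !mxE (inj_eq lift_inj).
Qed.

Theorem mainTheorem2 (R : realType) (n m p : nat)
    (n_gt0 : (0 < n)%N) (m_gt0 : (0 < m)%N) (p_gt0 : (0 < p)%N)
    (le_pm : (p <= m)%N) (le_mnp : (m <= n - p)%N)
    (x : 'rV[R]_p -> 'cV[R[i]]_n) (theta : 'rV[R]_p) (G : 'M[R[i]]_(n, p))
    (G_col : forall i : 'I_p, is_partial_derive x theta i (col i G))
    (G_rank : \rank G = p)
    (sigma2 : R) (sigma2_gt0 : 0 < sigma2)
    (d : measure_display) (Omega : measurableType d)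
    (P : probability Omega R) (Phi : {RV P >-> 'M[R[i]]_(m, n)})
    (g : 'M[R[i]]_m -> R)
    (Phi_density :
       has_density Phi mx_lebesgue_measure (fun Z => g (Z *m Z ^t*))) :
  forall i : 'I_p,
    has_law P
      (fun w => cramer_rao (fisher_compressed sigma2 (Phi w) G) i
                / cramer_rao (fisher sigma2 G) i)
      (inverse_law (beta_prob (m - p + 1) (n - m))).
Proof.
move=> i; set ratio := fun Z : 'M[R[i]]_(m, n) =>
  cramer_rao (fisher_compressed sigma2 Z G) i / cramer_rao (fisher sigma2 G) i.
have mratio : measurable_fun setT ratio by exact: measurable_cramer_rao_ratio.
split=> [|A mA].
  exact: (measurableT_comp mratio (@measurable_funPT _ _ _ _ Phi)).
(* [q] counts the other parameters, [k] is the rank of the projector left once their columns are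
   removed, and [k + l = n - q]. Positivity of [l] comes from [m <= n - p] and [0 < p]. *)
pose q := p.-1; pose k := (m - p + 1)%N; pose l := (n - m)%N.
have k0 : (0 < k)%N by rewrite /k addn1.
have l0 : (0 < l)%N by rewrite /l; lia.
have mkq : m = (k + q)%N by rewrite /k /q; lia.
have nklq : n = (k + l + q)%N by rewrite /k /l /q; lia.
pose X := col' i G; pose E := col' i (1%:M : 'M[R[i]]_p); pose E' :=
  row' i (1%:M : 'M[R[i]]_p).
have E'E : E' *m E = 1%:M by exact: row'_col'1.
have XE : X = G *m E by rewrite /X /E !col'Esub mulmx_colsub mulmx1.
pose G' := pinvmx G.
have G'G : G' *m G = 1%:M by rewrite mulVpmx// /row_full G_rank.
have X'X : E' *m G' *m X = 1%:M by rewrite XE -mulmxA (mulmxA G') G'G mul1mx.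
have XX : X ^t* *m X \in unitmx := inv_gram_unit X'X.
have GG : G ^t* *m G \in unitmx := inv_gram_unit G'G.
have X1X : X ^t* *m 1%:M *m X \in unitmx by rewrite mulmx1.
have [B BB BX] : exists2 B : 'M[R[i]]_(k + l, n),
    B *m B ^t* = 1%:M & resid 1%:M X = B ^t* *m B.
  apply: proj_onb.
  - exact/resid_trmxC/trmxC1.
  - exact: (resid_idem X1X (mulmx1 _)).
  - rewrite tr_resid//; last exact: mulmx1.
    by rewrite mxtrace1 [in LHS]nklq natrD addrK.
pose W := B ^t*.
have WW : W ^t* *m W = 1%:M by rewrite /W trmxCK.
have WWX : resid 1%:M X = W *m W ^t* by rewrite /W trmxCK.
have WX : W ^t* *m X = 0.
  by rewrite -[W ^t*]mul1mx -WW -(mulmxA _ W) -WWX -mulmxA residX// mulmx0.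
pose v0 := W ^t* *m col i G.
pose lm := @mx_lebesgue_measure R m n.
have aeG : {ae lm, forall Z, compressible X Z /\ G ^t* *m proj_adj Z *m G \in
  unitmx}.
  have mn : (m <= n)%N by rewrite nklq mkq; lia.
  have h1 := @ae_gram_unit R m n mn.
  have h2 := ae_left_inverse le_pm G'G.
  move: h1 h2; apply: filterS2 => Z ZZ [Y YG].
  split; last exact: compressed_gram_unit YG.
  (* A left inverse of [Z G] restricts to one of [Z X], because [X = G E] and [E' E = 1]. *)
  split; [exact: ZZ|apply: (compressed_gram_unit ZZ (Y := E' *m Y))].
  by rewrite XE -E'E -[E in RHS]mul1mx -YG !mulmxA.
have [mf f0 fE] := Phi_density; set f := fun Z : 'M[R[i]]_(m, n) =>
  g (Z *m Z ^t*) in mf f0 fE.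
have v00 : v0 != 0.
  have := @invmx_gram_diag _ _ _ 1%:M G i (trmxC1 _ _).
  rewrite !mulmx1 => /(_ GG XX) [+ _]; rewrite -/X WWX; apply: contra_neq =>
    v0E.
  by rewrite mulmxA -mulmxA -/v0 v0E mulmx0 mxE.
have f1 : (\int[lm]_Z (f Z)%:E)%E = 1%E.
  by rewrite -fE// /distribution /pushforward preimage_setT probability_setT.
have fU (U : 'M[R[i]]_n) Z : U *m U ^t* = 1%:M -> f (Z *m U) = f Z.
  by move=> UU; rewrite /f trmxCM mulmxA -(mulmxA Z) UU mulmx1.
rewrite -[inverse_law _]/(inverse_law (beta_prob k l)).
rewrite -(@crb_ratio_law R n q k l m X W f v0 A)//; last first.
  by move: aeG; apply: filterS => Z [].
have mrA (r : 'M[R[i]]_(m, n) -> R[i]) : measurable_fun setT r ->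
  measurable [set Z | A (r Z)].
  by move=> mr; rewrite -[X in measurable X]setTI; exact: mr.
have mc : measurable_fun setT (fun Z : 'M[R[i]]_(m, n) => crb_ratio X W Z v0).
  by apply: measurable_crb_ratio; [exact: measurable_id|exact: measurable_cst].
(* The two statistics agree off a null set only, so the domains of integration differ; extension by
   zero turns this into an almost everywhere equality of integrands. *)
transitivity (\int[lm]_(Z in [set Z | A (ratio Z)]) (f Z)%:E)%E.
  by rewrite -fE//; exact: mrA.
rewrite integral_mkcond [RHS]integral_mkcond; apply: ae_eq_integral => //.
- apply/(measurable_restrictT _ _).1; first exact: mrA.
  by apply: measurable_funTS; exact/measurable_EFinP.
- apply/(measurable_restrictT _ _).1; first exact: mrA.
  by apply: measurable_funTS; exact/measurable_EFinP.
move: aeG; apply: filterS => Z [[ZZ XZ] GZ] _; rewrite !patchE.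
have [rE _] := cramer_rao_ratio (lt0r_neq0 sigma2_gt0) WWX GG XX XZ GZ.
by congr (if _ then _ else _); apply/idP/idP; rewrite !inE /= /ratio rE.
Qed.
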